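(* Let $\Omega\subset\mathbb{C}^n$ be a hyperbolic domain, $p\in\partial\Omega$ and $\lambda\ge 1$. Let $U\subset\mathbb{C}^n$ be a bounded neighbourhood of $p$, and assume that at least one of the following holds: (1) $p$ is a $\lambda$-visible point for $\Omega$; (2) $p$ is a $\lambda$-visible point for $\Omega\cap U$ and $\Omega$ is hyperbolic at $p$. Then there exist a neighbourhood $V\subset\subset U$ of $p$ and a constant $C\ge 0$ such that for all $z,w\in\Omega\cap V$ belonging to the same connected component of $\Omega\cap U$, $$k_{\Omega\cap U}(z,w)\le k_\Omega(z,w)+C.$$
   Context: Neighbourhoods are open subsets of $\mathbb{C}^n$; $A\subset\subset B$ means that the closure of $A$ is compact and contained in $B$. $\Delta\subset\mathbb{C}$ is the open unit disc. For a domain $\Omega\subset\mathbb{C}^n$, $z,w\in\Omega$, $v\in\mathbb{C}^n$: $\tilde l_\Omega(z,w)=\inf\{|\alpha|:\exists\,\varphi:\Delta\to\Omega \text{ holomorphic},\ \varphi(0)=z,\ \varphi(\alpha)=w\}$; the Lempert function is $l_\Omega(z,w)=\tanh^{-1}\tilde l_\Omega(z,w)$; the Kobayashi pseudodistance $k_\Omega$ is the largest pseudodistance on $\Omega$ not exceeding $l_\Omega$; the Kobayashi-Royden pseudometric is $\kappa_\Omega(z;v)=\inf\{|\alpha|:\exists\,\varphi:\Delta\to\Omega \text{ holomorphic},\ \varphi(0)=z,\ \alpha\varphi'(0)=v\}$. For an absolutely continuous curve $\gamma:I\to\Omega$ ($I$ a compact interval), its Kobayashi-Royden length is $l^\kappa_\Omega(\gamma)=\int_I\kappa_\Omega(\gamma(t);\gamma'(t))\,dt$.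 For an open set such as $\Omega\cap U$ that may be disconnected, these objects are computed in the relevant connected component. $\Omega$ is hyperbolic if $k_\Omega$ is a distance. For $p\in\partial\Omega$, $\Omega$ is said to be hyperbolic at $p$ if either $\Omega$ is bounded, or $\Omega$ is unbounded and $\liminf_{z\to p,\,w\to\infty} l_\Omega(z,w)>0$ (with $z,w\in\Omega$). For $\lambda\ge1$, $\epsilon\ge0$, an absolutely continuous curve $\gamma:I\to\Omega$ is a $(\lambda,\epsilon)$-geodesic for $\Omega$ if $l^\kappa_\Omega(\gamma|_{[t_1,t_2]})\le\lambda k_\Omega(\gamma(t_1),\gamma(t_2))+\epsilon$ for all $t_1\le t_2$ in $I$. A point $p\in\partial\Omega$ is a $(\lambda,\epsilon)$-visible point for $\Omega$ if for any bounded neighbourhood $U$ of $p$ there exist a neighbourhood $V\subset\subset U$ of $p$ and a compact set $K_{\lambda,\epsilon}\subset\Omega$ such that every $(\lambda,\epsilon)$-geodesic $\gamma:I\to\Omega$ for $\Omega$ joining a point of $\Omega\cap V$ to a point of $\Omega\setminus U$ satisfies $\gamma(I)\cap K_{\lambda,\epsilon}\ne\emptyset$. It is a $\lambda$-visible point for $\Omega$ if it is $(\lambda,\epsilon)$-visible for $\Omega$ for all $\epsilon\ge0$. *)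

(* Defs.v *)
From HB Require Import structures.
From mathcomp Require Import all_boot all_order all_algebra.
From mathcomp Require Import complex.
From mathcomp Require Import all_classical all_reals all_analysis.

Set Implicit Arguments.
Unset Strict Implicit.
Unset Printing Implicit Defensive.

Import Order.TTheory GRing.Theory Num.Theory.
Import numFieldNormedType.Exports.

Local Open Scope classical_set_scope.
Local Open Scope ring_scope.

(* The regular module R[i]^o (convertible to R[i]) carries the topology and the
   R[i]-normed-module structure of the complex plane. *)
Notation CC R := ((complex R)^o) (only parsing).

(* C^(n+1): a positive dimension is needed for the normed-module structure, and
   nothing is lost since the only nonempty subset of C^0 has no boundary. *)
Notation Cn R n := ('rV[CC R]_n.+1) (only parsing).

Section Definitions.
Variables (R : realType) (n : nat).
Implicit Types (D G U V K : set (Cn R n)) (p z w v : Cn R n).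
Implicit Types (phi : CC R -> Cn R n) (gamma : R -> Cn R n).
Implicit Types (d : Cn R n -> Cn R n -> \bar R).

Definition cmod (a : CC R) : R := Normc.normc a.

Definition enorm v : R := Num.sqrt (\sum_j cmod (v ord0 j) ^+ 2).

Definition is_domain D := [/\ D !=set0, open D & connected D].

Definition boundary D : set (Cn R n) := closure D `\` interior D.

Definition neighbourhood p U := open U /\ U p.

Definition relatively_compact V U := compact (closure V) /\ closure V `<=` U.

Definition unit_disc : set (CC R) := [set a | cmod a < 1].

(* Discs are total functions of which only the restriction to the unit disc
   matters; derivability is over the complex field, hence holomorphy. *)
Definition holomorphic_disc D phi :=
  (forall a, unit_disc a -> derivable phi a 1) /\
  (forall a, unit_disc a -> D (phi a)).

Local Open Scope ereal_scope.

(* +oo when no disc through z and w exists. *)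
Definition lempert_tilde D z w : \bar R :=
  ereal_inf [set (cmod a)%:E | a in [set a | unit_disc a /\
    exists phi, [/\ holomorphic_disc D phi, phi 0%R = z & phi a = w]]].

Definition artanh (x : \bar R) : \bar R :=
  match x with
  | r%:E => if (r < 1)%R then (ln ((1 + r) / (1 - r)) / 2)%:E else +oo
  | +oo => +oo
  | -oo => -oo
  end.

Definition lempert D z w : \bar R := artanh (lempert_tilde D z w).

Definition pseudodistance D d :=
  [/\ forall z w, D z -> D w -> 0 <= d z w < +oo,
      forall z, D z -> d z z = 0,
      forall z w, D z -> D w -> d z w = d w z &
      forall x y z, D x -> D y -> D z -> d x z <= d x y + d y z].

Definition distance D d :=
  pseudodistance D d /\ forall z w, D z -> D w -> d z w = 0 -> z = w.

Definition kobayashi D z w : \bar R :=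
  ereal_sup [set d z w | d in [set d | pseudodistance D d /\
    forall x y, D x -> D y -> d x y <= lempert D x y]].

Definition kobayashi_royden D z v : \bar R :=
  ereal_inf [set (cmod a)%:E | a in [set a : CC R |
    exists phi, [/\ holomorphic_disc D phi, phi 0%R = z
                  & (a *: 'D_1 phi 0 = v)%R]]].

(* For an open set that may be disconnected, everything is computed in the
   connected component of the base point; if the set is connected this changes
   nothing (connected_component_id). *)
Definition kobayashi_comp G z w := kobayashi (connected_component G z) z w.

Definition kobayashi_royden_comp G z v :=
  kobayashi_royden (connected_component G z) z v.

Definition hyperbolic D := distance D (kobayashi D).

Definition at_infinity : set_system (Cn R n) :=
  [set A | exists M : R, forall w, (M < enorm w)%R -> A w].

Definition hyperbolic_at D p :=
  bounded_set D \/
  ~ bounded_set D /\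
  0 < limf_einf (fun zw : Cn R n * Cn R n => lempert D zw.1 zw.2)
        (filter_prod (within D (nbhs p)) (within D at_infinity)).

Definition absolutely_continuous (a b : R) gamma :=
  forall e : R, (0 < e)%R -> exists2 dl : R, (0 < dl)%R &
    forall (m : nat) (s t : 'I_m -> R),
      (forall k, [/\ a <= s k, s k <= t k & t k <= b])%R ->
      trivIset setT (fun k => `]s k, t k[%classic) ->
      (\sum_(k < m) (t k - s k) < dl)%R ->
      (\sum_(k < m) enorm (gamma (t k) - gamma (s k)) < e)%R.

Definition curve G (a b : R) gamma :=
  absolutely_continuous a b gamma /\ forall t, t \in `[a, b] -> G (gamma t).

(* Derivative with respect to the real parameter, defined at almost every time
   of an absolutely continuous curve; elsewhere the value is irrelevant. *)
Definition velocity gamma (t : R) : Cn R n :=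
  \row_j Complex (derive1 (fun s => complex.Re (gamma s ord0 j)) t)
                 (derive1 (fun s => complex.Im (gamma s ord0 j)) t).

Definition kr_length G (t1 t2 : R) gamma : \bar R :=
  \int[@lebesgue_measure R]_(t in `[t1, t2])
    kobayashi_royden_comp G (gamma t) (velocity gamma t).

Definition geodesic (lambda eps : R) G (a b : R) gamma :=
  curve G a b gamma /\
  forall t1 t2 : R, (a <= t1)%R -> (t1 <= t2)%R -> (t2 <= b)%R ->
    kr_length G t1 t2 gamma <=
      lambda%:E * kobayashi_comp G (gamma t1) (gamma t2) + eps%:E.

Definition visible2 (lambda eps : R) G p :=
  forall U, neighbourhood p U -> bounded_set U ->
  exists V K, [/\ neighbourhood p V, relatively_compact V U,
    compact K, K `<=` G &
    forall (a b : R) gamma, (a <= b)%R -> geodesic lambda eps G a b gamma ->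
      (G `&` V) (gamma a) -> (G `\` U) (gamma b) ->
      exists2 t, t \in `[a, b] & K (gamma t)].

Definition visible (lambda : R) G p :=
  forall eps : R, (0 <= eps)%R -> visible2 lambda eps G p.

End Definitions.

(* Main.v *)
Require Import Defs.
From mathcomp Require Import all_boot all_order all_algebra.
From mathcomp Require Import complex ring lra.
From mathcomp Require Import all_classical all_reals all_analysis.
From mathcomp Require Import measurable_realfun.
Import Order.TTheory GRing.Theory Num.Theory.
Import numFieldNormedType.Exports.
Local Open Scope classical_set_scope.
Local Open Scope ring_scope.

(* Write D = Omega `&` U and fix o in Omega. A disc in Omega centred at x stays in
   U on the disc of radius r(x) = tanh l(x, Omega `\` U), so in D distances and
   infinitesimal lengths at x grow at most by the factor 1 / r(x). The heart of the
   matter is that 1 / r(x) <= 1 + B exp (- 2 k(x, o)) for x near p: in case (1) an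
   almost geodesic of Omega from x to the outside of U meets a fixed compact set; in
   case (2) almost geodesics of D do so, and one compares the radii at which a disc
   leaves a small neighbourhood of p and leaves U. Along an almost geodesic of Omega
   run at unit speed, k(., o) grows at least like |t - c| / 2, hence the excess
   1 / r - 1 is integrable with a uniform bound, and an almost geodesic of Omega
   staying near p is an almost geodesic of D, up to an additive constant. One that
   does not stay near p meets, by visibility, a compact subset of D near each of
   its ends, and the Kobayashi distance of D is bounded on this compact set. *)

Set Implicit Arguments.
Unset Strict Implicit.
Unset Printing Implicit Defensive.

(** * Norms and topology on C^n *)

(** The exponent 2 comes from 1 - tanh t <= 2 exp (- 2 t): a disc centred at x that reaches a point
    at Kobayashi distance at least k(x, o) - C does so at a parameter whose distance to the unit
    circle is at most a constant times exp (- 2 k(x, o)). Case (2) has to avoid a circle: an almost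
    geodesic of Omega is recognized as one of D only through the bound on 1 / r, and this bound must
    itself come from visibility for D. It is therefore derived from almost geodesics of the
    components of D, with excess 1; visibility is then applied again, with an excess depending on
    the constant B just found. Hyperbolicity at p keeps discs centred near p inside U up to a fixed
    radius, which is what makes the two exit radii comparable. Curves are built from chords of
    discs, so that they are affine off finitely many times. Their velocity is explicit, distance
    estimates follow from estimates at a single point by continuous induction, and an integral only
    appears in the upper bound for lengths. *)

Definition rc {R : realType} (t : R) : CC R := real_complex R t.
Arguments rc : simpl never.
Arguments cmod : simpl never.

Section Norms.
Context {R : realType} {n : nat}.
Implicit Types (a b : CC R) (v w x y : Cn R n).

Lemma cmod_ge0 a : 0 <= cmod a.
Proof. by case: a => x y; rewrite /cmod /= sqrtr_ge0. Qed.

Lemma cmod0 : cmod (0 : CC R) = 0.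
Proof. exact: Normc.normc0. Qed.

Lemma cmod1 : cmod (1 : CC R) = 1.
Proof. exact: Normc.normc1. Qed.

Lemma cmodM a b : cmod (a * b) = cmod a * cmod b.
Proof. exact: Normc.normcM. Qed.

Lemma cmodV a : cmod a^-1 = (cmod a)^-1.
Proof. exact: Normc.normcV. Qed.

Lemma cmodN a : cmod (- a) = cmod a.
Proof. exact: normcN. Qed.

Lemma cmodD a b : cmod (a + b) <= cmod a + cmod b.
Proof. exact: le_normcD. Qed.

Lemma cmod_eq0 a : cmod a = 0 -> a = 0.
Proof. exact: Normc.eq0_normc. Qed.

Lemma cmod_rc (t : R) : cmod (rc t) = `|t|.
Proof. by rewrite /cmod /rc /= expr0n /= addr0 sqrtr_sqr. Qed.

Lemma rc0 : rc (0 : R) = 0. Proof. exact: (rmorph0 (real_complex R)). Qed.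

Lemma rc1 : rc (1 : R) = 1. Proof. exact: (rmorph1 (real_complex R)). Qed.

Lemma rcD (s t : R) : rc (s + t) = rc s + rc t.
Proof. exact: (rmorphD (real_complex R)). Qed.

Lemma rcN (t : R) : rc (- t) = - rc t.
Proof. exact: (rmorphN (real_complex R)). Qed.

Lemma rcB (s t : R) : rc (s - t) = rc s - rc t.
Proof. exact: (rmorphB (real_complex R)). Qed.

Lemma rcM (s t : R) : rc (s * t) = rc s * rc t.
Proof. exact: (rmorphM (real_complex R)). Qed.

Lemma rcV (t : R) : rc t^-1 = (rc t)^-1.
Proof. exact: (fmorphV (real_complex R)). Qed.

Lemma rcVK (t : R) : t != 0 -> rc t^-1 * rc t = 1.
Proof. by move=> t0; rewrite -rcM mulVf ?rc1. Qed.

Lemma normr_cmod a : `|a| = real_complex R (cmod a).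
Proof. by case: a. Qed.

(** The l^1 norm. It is real valued, while the library norm on [Cn R n] takes its values in the
    complex numbers. *)
Definition nrm v : R := \sum_j cmod (v ord0 j).

Lemma nrm_ge0 v : 0 <= nrm v.
Proof. by apply: sumr_ge0 => j _; exact: cmod_ge0. Qed.

Lemma nrm0 : nrm 0 = 0.
Proof. by apply: big1 => j _; rewrite mxE cmod0. Qed.

Lemma cmod_le_nrm v j : cmod (v ord0 j) <= nrm v.
Proof.
rewrite /nrm (bigD1 j) //= lerDl; apply: sumr_ge0 => k _; exact: cmod_ge0.
Qed.

Lemma nrmD v w : nrm (v + w) <= nrm v + nrm w.
Proof.
rewrite /nrm -big_split /=; apply: ler_sum => j _; rewrite mxE; exact: cmodD.
Qed.

Lemma nrmN v : nrm (- v) = nrm v.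
Proof. by apply: eq_bigr => j _; rewrite mxE cmodN. Qed.

Lemma nrmZ a v : nrm (a *: v) = cmod a * nrm v.
Proof. by rewrite /nrm mulr_sumr; apply: eq_bigr => j _; rewrite mxE cmodM. Qed.

Lemma nrmB v w : nrm (v - w) = nrm (w - v).
Proof. by rewrite -nrmN opprB. Qed.

Lemma nrm_triangle x v w : nrm (v - w) <= nrm (v - x) + nrm (x - w).
Proof. by apply: le_trans (nrmD _ _); rewrite addrA subrK. Qed.

Lemma enorm_le_nrm v : enorm v <= nrm v.
Proof.
rewrite /enorm -[leRHS]ger0_norm ?nrm_ge0// -sqrtr_sqr ler_wsqrtr// /nrm.
suff : 0 <= \sum_j cmod (v ord0 j) /\
    \sum_j cmod (v ord0 j) ^+ 2 <= (\sum_j cmod (v ord0 j)) ^+ 2 by case.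
elim/big_rec2: _ => [|j s t _ [h0 h]]; first by rewrite expr0n.
have c0 := cmod_ge0 (v ord0 j).
by split; nra.
Qed.

Lemma cmod_le_enorm v j : cmod (v ord0 j) <= enorm v.
Proof.
rewrite -[leLHS]ger0_norm ?cmod_ge0// -sqrtr_sqr ler_wsqrtr//.
rewrite (bigD1 j) //= lerDl; apply: sumr_ge0 => k _; exact: sqr_ge0.
Qed.

Lemma nrm_le_enorm v : nrm v <= n.+1%:R * enorm v.
Proof.
rewrite -[X in X%:R * _]card_ord mulr_natl -sumr_const.
by apply: ler_sum => j _; exact: cmod_le_enorm.
Qed.

Lemma nbhs_cmodP a (A : set (CC R)) :
  nbhs a A <-> exists2 r : R, 0 < r & forall b, cmod (b - a) < r -> A b.
Proof.
split=> [/nbhs_ballP[e /= e0 eA]|[r r0 rA]].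
(* Radii of library balls are complex, and a positive one is real: its real part is the radius
   wanted. *)
- exists (complex.Re e); first by move: e0; rewrite ltcE /= => /andP[].
  move=> b ba; apply: eA; rewrite /ball /= -normrN opprB normr_cmod.
  by move: e0; rewrite !ltcE /= => /andP[-> _]; rewrite ba.
- apply/nbhs_ballP; exists (real_complex R r); first by rewrite /= ltcR.
  move=> b; rewrite /ball /= -normrN opprB normr_cmod ltcR => ba; exact: rA.
Qed.

Lemma nbhs_nrmP x (A : set (Cn R n)) :
  nbhs x A <-> exists2 r : R, 0 < r & forall y, nrm (y - x) < r -> A y.
Proof.
split=> [/nbhs_ballP[e /= e0 eA]|[r r0 rA]].
- exists (complex.Re e); first by move: e0; rewrite ltcE /= => /andP[].
  move=> y yx; apply: eA; split => // i j; rewrite ord1.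
  have := le_lt_trans (cmod_le_nrm (y - x) j) yx; rewrite !mxE => cj.
  rewrite /ball /= -normrN opprB normr_cmod.
  by move: e0; rewrite !ltcE /= => /andP[-> _]; rewrite cj.
- apply/nbhs_ballP; exists (real_complex R (r / n.+2%:R)).
    by rewrite /= ltcR divr_gt0.
  move=> y [_ yx]; apply: rA.
  apply: (@le_lt_trans _ _ (\sum_(j < n.+1) r / n.+2%:R)).
    apply: ler_sum => j _; have := yx ord0 j.
    by rewrite /ball /= -normrN opprB normr_cmod ltcR !mxE => /ltW.
  rewrite sumr_const card_ord -[_ *+ n.+1]mulr_natr -mulrA gtr_pMr//.
  by rewrite mulrC ltr_pdivrMr ?ltr0n// mul1r ltr_nat.
Qed.


Lemma open_nrm_ball x (r : R) : open [set y | nrm (y - x) < r].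
Proof.
rewrite openE => y /= yr; apply/nbhs_nrmP; exists (r - nrm (y - x)).
  by rewrite subr_gt0.
move=> z zy; apply: le_lt_trans (nrm_triangle y _ _) _.
by rewrite -ltrBrDr.
Qed.

Lemma closed_nrm_ball x (r : R) : closed [set y | nrm (y - x) <= r].
Proof.
rewrite -openC openE => y /= /negP; rewrite -ltNge => yr.
apply/nbhs_nrmP; exists (nrm (y - x) - r); first by rewrite subr_gt0.
move=> z zy /=; apply/negP; rewrite -ltNge.
have := nrm_triangle z y x; rewrite (nrmB y z); lra.
Qed.

Lemma open_nrmP (A : set (Cn R n)) x : open A -> A x ->
  exists2 r : R, 0 < r & forall y, nrm (y - x) < r -> A y.
Proof. by rewrite openE => Ao Ax; apply/nbhs_nrmP; exact: Ao. Qed.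


Lemma complex_pair_continuous :
  continuous (fun q : R * R => (Complex q.1 q.2 : CC R)).
Proof.
move=> [s t] A /nbhs_cmodP[r r0 rA]; apply/nbhs_ballP.
exists (r / 2) => /=; first by rewrite divr_gt0.
move=> [s' t'] [ss tt]; apply: rA; rewrite /= in ss tt.
rewrite -[fst _]/s' -[snd _]/t' -[fst (s, t)]/s -[snd (s, t)]/t.
rewrite (_ : _ - _ = rc (s' - s) + Complex 0 1 * rc (t' - t)); last first.
  by apply/eqP; rewrite eq_complex /rc /=; apply/andP; split; apply/eqP; ring.
apply: (le_lt_trans (cmodD _ _)); rewrite cmodM !cmod_rc.
have -> : cmod (Complex 0 1 : CC R) = 1.
  by rewrite /cmod /= expr0n add0r expr1n sqrtr1.
move: ss tt; rewrite /ball /= distrC => ss; rewrite distrC; lra.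
Qed.

Lemma normr_Re_le a : `|complex.Re a| <= cmod a.
Proof.
case: a => s t; rewrite /cmod /= -sqrtr_sqr ler_wsqrtr// lerDl; exact: sqr_ge0.
Qed.

Lemma normr_Im_le a : `|complex.Im a| <= cmod a.
Proof.
case: a => s t; rewrite /cmod /= -sqrtr_sqr ler_wsqrtr// lerDr; exact: sqr_ge0.
Qed.

Lemma closed_cmod_ball a (r : R) : closed [set b : CC R | cmod (b - a) <= r].
Proof.
rewrite -openC openE => y /= /negP; rewrite -ltNge => yr.
apply/nbhs_cmodP; exists (cmod (y - a) - r); first by rewrite subr_gt0.
move=> z zy /=; apply/negP; rewrite -ltNge.
have h : cmod (y - a) <= cmod (y - z) + cmod (z - a).
  by apply: le_trans (cmodD _ _); rewrite addrA subrK.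
by move: h; rewrite -[cmod (y - z)]cmodN opprB; lra.
Qed.

(** The disc is a closed subset of a square, which is the continuous image of a compact rectangle of
    the real plane. *)
Lemma compact_cmod_ball a (r : R) : compact [set b : CC R | cmod (b - a) <= r].
Proof.
pose Q : set (CC R) := [set (Complex q.1 q.2 : CC R) | q in
  `[complex.Re a - r, complex.Re a + r]%classic `*`
  `[complex.Im a - r, complex.Im a + r]%classic].
have Qc : compact Q.
  apply: continuous_compact.
    exact: continuous_subspaceT complex_pair_continuous.
  apply: compact_setX; exact: segment_compact.
have -> : [set b : CC R | cmod (b - a) <= r] =
    Q `&` [set b : CC R | cmod (b - a) <= r].
  apply/seteqP; split=> [b /= br|b []//]; split=> //.
  exists (complex.Re b, complex.Im b); last by case: (b).
  have h1 := le_trans (normr_Re_le (b - a)) br.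
  have h2 := le_trans (normr_Im_le (b - a)) br.
  move: h1 h2; rewrite !ler_norml.
  by case: (b) (a) => s t [s' t'] /=; split=> /=; rewrite ?in_itv /=; lra.
exact: (compact_closedI Qc (@closed_cmod_ball a r)).
Qed.

Lemma compact_nrm_ball x (r : R) : compact [set y : Cn R n | nrm (y - x) <= r].
Proof.
pose Q : set (Cn R n) := [set y : Cn R n | forall j,
  [set b : CC R | cmod (b - x ord0 j) <= r] (y ord0 j)].
have Qc : compact Q.
  apply: (@rV_compact (CC R) n.+1 (fun j => [set b | cmod (b - x ord0 j) <= r])).
  by move=> j; exact: compact_cmod_ball.
have -> : [set y : Cn R n | nrm (y - x) <= r] =
    Q `&` [set y | nrm (y - x) <= r].
  apply/seteqP; split=> [b /= br|b []//]; split=> // j /=.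
  by apply: le_trans br; apply: le_trans (cmod_le_nrm _ j); rewrite !mxE.
exact: (compact_closedI Qc (@closed_nrm_ball x r)).
Qed.

End Norms.

(** * Holomorphic discs *)

Section Disc.
Context {R : realType} {n : nat}.
Implicit Types (a b h : CC R) (u v w x y : Cn R n) (phi psi : CC R -> Cn R n).
Implicit Types (G : set (Cn R n)).

(** The complex derivative without quotients and with real bounds; [cderivP] identifies it with the
    derivative in direction 1. *)
Definition cderiv phi a v := forall e : R, 0 < e -> exists2 d : R, 0 < d &
  forall h, cmod h < d -> nrm (phi (a + h) - phi a - h *: v) <= e * cmod h.

Lemma cderivP phi a v : cderiv phi a v <-> derivable phi a 1 /\ 'D_1 phi a = v.
Proof.
have E : cderiv phi a v <->
    ((fun h : (complex R : numFieldType) =>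
        h^-1 *: ((phi \o shift a) (h *: (1 : CC R)) - phi a))
      @ (0 : (complex R : numFieldType))^' --> v).
  split=> [H A /nbhs_nrmP[r r0 rA]|H e e0].
  - have [d d0 hd] := H (r / 2) ltac:(by rewrite divr_gt0).
    apply/nbhs_cmodP; exists d => // h; rewrite subr0 => hlt /= h0.
    apply: rA => /=; rewrite [_ *: (1 : CC R)]mulr1.
    have ch0 : 0 < cmod h.
      rewrite lt0r cmod_ge0 andbT; apply: contra_neq h0; exact: cmod_eq0.
    have -> : h^-1 *: (phi (h + a) - phi a) - v
        = h^-1 *: (phi (a + h) - phi a - h *: v).
      by rewrite [in RHS]scalerBr scalerA mulVf // scale1r addrC [h + a]addrC addrC.
    rewrite nrmZ cmodV -(ltr_pM2l ch0) mulrA divff ?gt_eqF// mul1r.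
    apply: (le_lt_trans (hd _ hlt)); rewrite mulrC ltr_pM2l//; lra.
  - have /nbhs_cmodP[d d0 hd] := H [set y | nrm (y - v) < e]
      (proj2 (nbhs_nrmP _ _) (ex_intro2 _ _ e e0 (fun y => id))).
    exists d => // h hlt.
    have [->|h0] := eqVneq h 0.
      by rewrite addr0 subrr scale0r subr0 nrm0 cmod0 mulr0.
    have := hd h; rewrite subr0 => /(_ hlt h0) /=; rewrite [_ *: (1 : CC R)]mulr1.
    have ch0 : 0 < cmod h.
      rewrite lt0r cmod_ge0 andbT; apply: contra_neq h0; exact: cmod_eq0.
    have -> : h^-1 *: (phi (h + a) - phi a) - v
        = h^-1 *: (phi (a + h) - phi a - h *: v).
      by rewrite [in RHS]scalerBr scalerA mulVf // scale1r addrC [h + a]addrC addrC.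
    rewrite nrmZ cmodV -(ltr_pM2l ch0) mulrA divff ?gt_eqF// mul1r.
    by rewrite mulrC => /ltW.
rewrite E; split=> [H|[H1 <-] //].
by split; [apply: cvgP H | exact: cvg_lim H].
Qed.


Lemma derivable_comp1 phi (f : CC R -> CC R) a :
  derivable f a 1 -> derivable phi (f a) 1 -> derivable (phi \o f) a 1.
Proof.
move=> /derivable1_diffP fa /derivable1_diffP pa; apply/derivable1_diffP.
exact: differentiable_comp.
Qed.

Lemma disc_rescale G phi b : cmod b <= 1 -> holomorphic_disc G phi ->
  holomorphic_disc G (fun h => phi (b * h)).
Proof.
move=> b1 [phid phiG].
have bD a : unit_disc a -> unit_disc (b * a).
  rewrite /unit_disc /= cmodM => a1.
  have := cmod_ge0 a; have := cmod_ge0 b; nra.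
split=> a a1; last exact/phiG/bD.
apply: (@derivable_comp1 phi (fun h => b * h)); last exact/phid/bD.
by apply: derivableM; [exact: derivable_cst | exact: derivable_id].
Qed.

Lemma mobius_lt1 (c : R) a : `|c| < 1 -> cmod a < 1 ->
  1 + rc c * a != 0 /\ cmod ((a + rc c) / (1 + rc c * a)) < 1.
Proof.
move=> c1 a1.
have n0 : 1 + rc c * a != 0.
  apply/eqP => /eqP; rewrite addrC addr_eq0 => /eqP e.
  have : cmod (rc c * a) = 1 by rewrite e cmodN cmod1.
  rewrite cmodM cmod_rc; have := cmod_ge0 a; have := normr_ge0 c; nra.
split=> //; rewrite cmodM cmodV ltr_pdivrMr; last first.
  rewrite lt0r cmod_ge0 andbT; apply: contra_neq n0; exact: cmod_eq0.
rewrite mul1r.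
have c2 : c ^+ 2 < 1 by rewrite -[ltLHS]real_normK ?num_real// expr_lt1.
have a2 : complex.Re a ^+ 2 + complex.Im a ^+ 2 < 1.
  move: a1; rewrite /cmod; case: (a) => s t /= a1.
  by rewrite -[ltLHS]sqr_sqrtr ?addr_ge0 ?sqr_ge0// expr_lt1 ?sqrtr_ge0.
rewrite /cmod /rc; case: (a) a2 => s t /= a2.
have h : (s + c) ^+ 2 + (t + 0) ^+ 2 <
    (1 + (c * s - 0 * t)) ^+ 2 + (0 + (c * t + 0 * s)) ^+ 2.
  (* The squared moduli of 1 + c a and a + c differ by (1 - c^2) (1 - |a|^2). *)
  have : 0 < (1 - c ^+ 2) * (1 - (s ^+ 2 + t ^+ 2)).
    by rewrite mulr_gt0 // subr_gt0.
  lra.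
rewrite ltr_sqrt //; apply: le_lt_trans h; by rewrite addr_ge0 ?sqr_ge0.
Qed.

(** Recentring at a point of the real diameter; discs are rotated beforehand so that the points of
    interest lie on it. *)
Lemma disc_mobius G phi (c : R) : `|c| < 1 ->
  holomorphic_disc G phi ->
  holomorphic_disc G (fun h => phi ((h + rc c) / (1 + rc c * h))).
Proof.
move=> c1 [phid phiG]; split=> a /(mobius_lt1 c1)[n0 a1]; last exact: phiG.
apply: (@derivable_comp1 phi (fun h => (h + rc c) / (1 + rc c * h))).
  apply: derivableM.
    by apply: derivableD; [exact: derivable_id | exact: derivable_cst].
  apply: derivableV; first exact: n0.
  apply: derivableD; first exact: derivable_cst.
  by apply: derivableM; [exact: derivable_cst | exact: derivable_id].
exact: phid.
Qed.

Lemma disc_cderiv G phi a : holomorphic_disc G phi -> cmod a < 1 ->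
  exists v, cderiv phi a v.
Proof. by move=> [pd _] a1; exists ('D_1 phi a); apply/cderivP; split=> //; exact: pd. Qed.

Lemma cderiv_cont phi a v (e : R) : cderiv phi a v -> 0 < e ->
  exists2 d : R, 0 < d & forall b, cmod (b - a) < d -> nrm (phi b - phi a) < e.
Proof.
move=> H e0; have [d d0 hd] := H 1 ltr01.
have v0 := nrm_ge0 v.
exists (Num.min d (e / (nrm v + 2))).
  by rewrite lt_min d0 divr_gt0// ltr_wpDl.
move=> b; rewrite lt_min => /andP[h1 h2].
have := hd _ h1; rewrite [a + _]addrC subrK mul1r => h3.
have := nrmD (phi b - phi a - (b - a) *: v) ((b - a) *: v).
rewrite subrK nrmZ => h4; apply: (le_lt_trans h4).
move: h2; rewrite ltr_pdivlMr; last by rewrite ltr_wpDl.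
have := cmod_ge0 (b - a).
nra.
Qed.

Lemma cderiv_rescale_affine phi (rho : R) (u v x : Cn R n) :
  cderiv phi 0 v -> 0 <= rho <= 1 ->
  cderiv (fun h => phi (rc rho * h) + x + h *: u) 0 (rc rho *: v + u).
Proof.
move=> H /andP[r0 r1] e e0; have [d d0 hd] := H e e0.
exists d => // h hlt.
have c0 := cmod_ge0 h.
have rh : cmod (rc rho * h) <= cmod h.
  by rewrite cmodM cmod_rc ger0_norm// ler_piMl.
have := hd (rc rho * h) (le_lt_trans rh hlt); rewrite add0r => h1.
rewrite add0r mulr0 scale0r addr0 scalerDr scalerA [h * _]mulrC.
set A := phi (rc rho * h) in h1 *; set B := (rc rho * h) *: v in h1 *.
have -> : A + x + h *: u - (phi 0 + x) - (B + h *: u) = A - phi 0 - B.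
  by apply/rowP => j; rewrite !mxE; ring.
by apply: (le_trans h1); rewrite ler_wpM2l// ltW.
Qed.

Lemma cderiv_scale (u : Cn R n) (a : CC R) : cderiv (fun h => h *: u) a u.
Proof.
move=> e e0; exists 1 => // h _.
by rewrite scalerDl addrAC addrK subrr nrm0 mulr_ge0 ?cmod_ge0// ltW.
Qed.

(** The closed disc of radius [rho] is compact, so its image has a neighbourhood of uniform size
    inside G. This leaves room for a translation x and a linear term of slope u, with which a disc
    is made to pass exactly through given points or to have a given derivative. *)
Lemma disc_perturb G phi (rho : R) : open G -> holomorphic_disc G phi ->
  0 <= rho < 1 -> exists2 d : R, 0 < d & forall x u, nrm x < d -> nrm u < d ->
  holomorphic_disc G (fun h => phi (rc rho * h) + x + h *: u).
Proof.
move=> Go pG /andP[r0 r1].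
have cK : compact [set a : CC R | cmod (a - 0) <= rho] := @compact_cmod_ball R 0 rho.
have H : \forall d \near (0 : R)^'+, [set a : CC R | cmod (a - 0) <= rho] `<=`
    (fun d : R => [set a | forall y, nrm (y - phi a) < 2 * d -> G y]) d.
  move: cK => /compact_near_coveringP; apply.
  move=> a /=; rewrite subr0 => ar.
  have a1 := le_lt_trans ar r1.
  have [e e0 eG] := open_nrmP Go (proj2 pG _ a1).
  have [v av] := disc_cderiv pG a1.
  have [d d0 hd] := cderiv_cont av (divr_gt0 e0 (ltr0Sn R 1)).
  exists ([set b | cmod (b - a) < d], [set t | t < e / 4]) => /=.
    split; first by apply/nbhs_cmodP; exists d.
    by apply: nbhs_right_lt; rewrite divr_gt0.
  move=> [b t] /= [bd te] y yt; apply: eG.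
  have := nrm_triangle (phi b) y (phi a); have := hd _ bd; lra.
have [d [d0 hd]] : exists d : R, 0 < d /\ [set a : CC R | cmod (a - 0) <= rho] `<=`
   [set a | forall y, nrm (y - phi a) < 2 * d -> G y].
  apply: (@filter_ex _ (0 : R)^'+); near=> d; split; near: d => //.
  exact: nbhs_right_gt.
exists d => // x u xd ud; split=> a a1; last first.
  apply: (hd (rc rho * a)) => /=.
    rewrite subr0 cmodM cmod_rc ger0_norm//.
    by rewrite ler_piMr// ltW.
  set A := phi _; have -> : A + x + a *: u - A = x + a *: u.
    by apply/rowP => j; rewrite !mxE; ring.
  apply: (le_lt_trans (nrmD _ _)); rewrite nrmZ.
  have := nrm_ge0 u; have := cmod_ge0 a; move: a1; rewrite /unit_disc /= => a1; nra.
have D1 : derivable (fun h => phi (rc rho * h)) a 1.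
  by apply: (proj1 (disc_rescale _ pG)) => //; rewrite cmod_rc ger0_norm// ltW.
apply: derivableD.
  by apply: derivableD; [exact: D1 | exact: derivable_cst].
exact: (proj1 ((proj1 (cderivP _ _ u)) (cderiv_scale u a))).
Unshelve. all: by end_near.
Qed.

End Disc.

(** * The Lempert function and the Kobayashi pseudometrics *)

Section Tanh.
Context {R : realType}.
Implicit Types (s t : R).

Definition th t : R := (expR (2 * t) - 1) / (expR (2 * t) + 1).

Lemma th_den t : 0 < expR (2 * t) + 1.
Proof. by rewrite addr_gt0 ?expR_gt0. Qed.

Lemma th0 : th 0 = 0.
Proof. by rewrite /th mulr0 expR0 subrr mul0r. Qed.

Lemma thN t : th (- t) = - th t.
Proof.
rewrite /th mulrN expRN; have := expR_gt0 (2 * t).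
move: (expR _) => E E0; field.
by rewrite !gt_eqF //; lra.
Qed.

Lemma th_lt1 t : th t < 1.
Proof. by rewrite /th ltr_pdivrMr ?th_den// mul1r; lra. Qed.

Lemma th_mono : {mono th : s t / s < t}.
Proof.
apply: leW_mono; apply: le_mono => s t st.
rewrite /th ltr_pdivrMr ?th_den// mulrAC ltr_pdivlMr ?th_den//.
have : expR (2 * s) < expR (2 * t) by rewrite ltr_expR ltr_pM2l.
lra.
Qed.

Lemma th_mono_le : {mono th : s t / s <= t}.
Proof. exact: le_mono (fun s t => etrans (th_mono s t)). Qed.

Lemma th_ge0 t : (0 <= th t) = (0 <= t).
Proof. by rewrite -{1}th0 th_mono_le. Qed.

Lemma th_gt0 t : (0 < th t) = (0 < t).
Proof. by rewrite -{1}th0 th_mono. Qed.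

Lemma thD s t : 1 + th s * th t != 0 /\
  th (s + t) = (th t + th s) / (1 + th s * th t).
Proof.
have h1 : 0 < 1 + th s * th t.
  have := th_lt1 s; have := th_lt1 t; have := th_lt1 (- s); have := th_lt1 (- t).
  rewrite !thN; nra.
split; first by rewrite gt_eqF.
have h2 := h1; move: h2; rewrite /th mulrDr expRD.
have := expR_gt0 (2 * s); have := expR_gt0 (2 * t).
move: (expR (2 * s)) (expR (2 * t)) => E F F0 E0 h.
apply: (@mulIf _ (1 + (E - 1) / (E + 1) * ((F - 1) / (F + 1)))).
  by rewrite gt_eqF.
rewrite divfK ?gt_eqF//; field.
by rewrite !gt_eqF //; nra.
Qed.

Lemma th_surj (a : R) : 0 <= a < 1 -> exists2 t, 0 <= t & th t = a.
Proof.
move=> /andP[a0 a1].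
have q0 : 0 < (1 + a) / (1 - a) by rewrite divr_gt0//; lra.
have E : th (ln ((1 + a) / (1 - a)) / 2) = a.
  rewrite /th [2 * _]mulrC divfK ?pnatr_eq0// lnK ?posrE//.
  field; rewrite !gt_eqF //; lra.
by exists (ln ((1 + a) / (1 - a)) / 2) => //; rewrite -th_ge0 E.
Qed.

Lemma artanh_th t : artanh (th t)%:E = t%:E.
Proof.
rewrite /artanh th_lt1; congr EFin.
have -> : (1 + th t) / (1 - th t) = expR (2 * t).
  rewrite /th; have := expR_gt0 (2 * t); move: (expR _) => E E0; field.
  by rewrite !gt_eqF //; lra.
by rewrite expRK mulrAC mulfV ?mul1r// pnatr_eq0.
Qed.

Lemma th_lower t : 0 <= t -> t / (1 + t) <= th t.
Proof.
move=> t0; rewrite /th ler_pdivlMr ?th_den// mulrAC ler_pdivrMr; last lra.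
have := expR_ge1Dx (2 * t); nra.
Qed.

Lemma th_upper t : 0 <= t < 2^-1 -> th t <= t / (1 - t).
Proof.
move=> /andP[t0 t1].
rewrite /th ler_pdivrMr ?th_den// mulrAC ler_pdivlMr; last lra.
have := expR_ge1Dx (- (2 * t)); rewrite expRN -[_^-1]mul1r ler_pdivlMr ?expR_gt0//.
nra.
Qed.

(** 1 - tanh t equals 2 / (exp (2 t) + 1). *)
Lemma th_exp t (a : R) : th t <= a -> 1 - a <= 2 * expR (- (2 * t)).
Proof.
move=> ta; apply: (@le_trans _ _ (1 - th t)); first lra.
have E0 := expR_gt0 (2 * t).
have -> : 1 - th t = 2 / (expR (2 * t) + 1).
  by rewrite /th; move: (expR _) E0 => E E0; field; rewrite gt_eqF //; lra.
rewrite expRN ler_pM2l// lef_pV2 ?posrE ?th_den//; lra.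
Qed.

End Tanh.

(** * Basic properties and localization of the invariant functions *)

Section Kobayashi.
Context {R : realType} {n : nat}.
Implicit Types (a b h : CC R) (u v w x y z : Cn R n) (phi psi : CC R -> Cn R n).
Implicit Types (G : set (Cn R n)).


Lemma lempert_tilde_ge0 G z w : (0 <= lempert_tilde G z w)%E.
Proof.
by apply: le_ereal_inf_tmp => _ [a _ <-]; rewrite lee_fin cmod_ge0.
Qed.

Variant artanh_spec : \bar R -> \bar R -> Prop :=
 | ArtanhFin (t : R) : (0 <= t) -> artanh_spec (th t)%:E t%:E
 | ArtanhInf (e : \bar R) : (1 <= e)%E -> artanh_spec e +oo%E.

Lemma artanhP (x : \bar R) : (0 <= x)%E -> artanh_spec x (artanh x).
Proof.
case: x => [r| |] //= r0; last by constructor; rewrite leey.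
case: ifPn => r1.
  have [t t0 tr] : exists2 t : R, (0 <= t) & th t = r.
    by apply: th_surj; rewrite r1 andbT -lee_fin.
  have := artanh_th t; rewrite tr /artanh r1 => ->; rewrite -tr.
  by constructor.
by constructor; rewrite lee_fin leNgt.
Qed.

Lemma lempert_ge0 G z w : (0 <= lempert G z w)%E.
Proof.
rewrite /lempert; case: artanhP => [|t t0|x _]; first exact: lempert_tilde_ge0.
  by rewrite lee_fin.
exact: leey.
Qed.

Lemma lempert_lt G z w (c : R) : (lempert G z w < c%:E)%E ->
  exists phi a, [/\ holomorphic_disc G phi, phi 0 = z, phi a = w &
    (cmod a < th c)].
Proof.
move=> H; have {H} : (lempert_tilde G z w < (th c)%:E)%E.
  move: H; rewrite /lempert; case: artanhP => //; first exact: lempert_tilde_ge0.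
  by move=> t t0; rewrite !lte_fin th_mono.
move=> /ereal_inf_lt[_ [a [a1 [phi [pG p0 pa]]] <-]]; rewrite lte_fin => ac.
by exists phi, a.
Qed.

Lemma lempert_le G phi a z w (c : R) : holomorphic_disc G phi -> phi 0 = z ->
  phi a = w -> (cmod a <= th c) -> (lempert G z w <= c%:E)%E.
Proof.
move=> pG p0 pa ac.
have {p0 pa pG} : (lempert_tilde G z w <= (th c)%:E)%E.
  apply: (@le_trans _ _ (cmod a)%:E); last by rewrite lee_fin.
  apply: ereal_inf_lbound; exists a => //; split; last by exists phi.
  exact: le_lt_trans ac (th_lt1 c).
rewrite /lempert; case: artanhP; first exact: lempert_tilde_ge0.
  by move=> t t0; rewrite !lee_fin th_mono_le.
by move=> x x1 /(le_trans x1); rewrite lee_fin leNgt th_lt1.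
Qed.

Lemma lempert_refl G x : G x -> (lempert G x x <= 0)%E.
Proof.
move=> Gx; apply: (@lempert_le G (fun=> x) 0) => //; last by rewrite th0 cmod0.
Qed.

Lemma lempert_sub G G' z w : G' `<=` G -> (lempert G z w <= lempert G' z w)%E.
Proof.
move=> GG; case E: (lempert G' z w) => [r| |]; last 2 first.
- by rewrite leey.
- by have := lempert_ge0 G' z w; rewrite E.
apply/lee_addgt0Pr => e e0; have /lempert_lt[phi [a [[pd pG] p0 pa ac]]] :
    (lempert G' z w < (r + e)%:E)%E by rewrite E lte_fin ltrDl.
rewrite -EFinD; apply: (lempert_le _ p0 pa (ltW ac)).
by split=> // b /pG /GG.
Qed.

Lemma kr_le G phi x v a : holomorphic_disc G phi -> phi 0 = x ->
  cderiv phi 0 v -> (kobayashi_royden G x (a *: v) <= (cmod a)%:E)%E.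
Proof.
move=> pG p0 /cderivP[_ pv]; apply: ereal_inf_lbound; exists a => //.
by exists phi; rewrite pv.
Qed.

Lemma kr_lt G x v (c : R) : (kobayashi_royden G x v < c%:E)%E ->
  exists phi a u, [/\ holomorphic_disc G phi, phi 0 = x, cderiv phi 0 u,
    (a *: u) = v & (cmod a < c)].
Proof.
move=> /ereal_inf_lt[_ [a [phi [pG p0 pv]] <-]]; rewrite lte_fin => ac.
exists phi, a, ('D_1 phi 0); split=> //; apply/cderivP; split=> //.
by apply: (proj1 pG); change (cmod (0 : CC R) < 1); rewrite cmod0.
Qed.

Lemma kr_ge0 G x v : (0 <= kobayashi_royden G x v)%E.
Proof. by apply: le_ereal_inf_tmp => _ [a _ <-]; rewrite lee_fin cmod_ge0. Qed.

(** Reversing a curve changes the sign of its velocity; the same disc serves, with the opposite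
    parameter. *)
Lemma kr_opp G x v : (kobayashi_royden G x v <= 1)%E ->
  (kobayashi_royden G x (- v) <= 1)%E.
Proof.
move=> H; apply/lee_addgt0Pr => e e0.
have /kr_lt[phi [a [u [pG p0 pu <- ac]]]] : (kobayashi_royden G x v < (1 + e)%:E)%E.
  by apply: (le_lt_trans H); rewrite lte_fin ltrDl.
rewrite -scaleNr; apply: (le_trans (kr_le _ pG p0 pu)).
by rewrite cmodN -EFinD lee_fin ltW.
Qed.

Lemma kr_localize G G' x v (r : R) : (0 < r <= 1) ->
  (forall phi, holomorphic_disc G phi -> phi 0 = x ->
    forall a, (cmod a < r) -> G' (phi a)) ->
  (kobayashi_royden G x v <= 1)%E -> (kobayashi_royden G' x v <= (r^-1)%:E)%E.
Proof.
move=> /andP[r0 r1] GG' H; apply/lee_addgt0Pr => e e0.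
have /kr_lt[phi [a [u [pG p0 pu <- ac]]]] :
    (kobayashi_royden G x v < (1 + e * r)%:E)%E.
  by apply: (le_lt_trans H); rewrite lte_fin ltrDl mulr_gt0.
have pG' : holomorphic_disc G' (fun h => phi (rc r * h)).
  split=> b b1.
    by apply: (proj1 (disc_rescale _ pG)) => //; rewrite cmod_rc gtr0_norm.
  apply: (GG' _ pG p0); rewrite cmodM cmod_rc gtr0_norm//.
  by rewrite gtr_pMr.
have cd : cderiv (fun h => phi (rc r * h)) 0 (rc r *: u).
  have r01 : 0 <= r <= 1 by rewrite (ltW r0).
  have := @cderiv_rescale_affine R n phi r 0 u 0 pu r01.
  rewrite addr0; suff -> : (fun h => phi (rc r * h) + 0 + h *: 0) =
    (fun h => phi (rc r * h)) by [].
  by apply/funext => h; rewrite addr0 scaler0 addr0.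
have p0' : phi (rc r * 0) = x by rewrite mulr0.
have -> : (a *: u = (a * rc r^-1) *: (rc r *: u)).
  by rewrite scalerA -mulrA rcVK ?gt_eqF// mulr1.
apply: (le_trans (kr_le _ pG' p0' cd)).
rewrite cmodM cmod_rc ger0_norm ?invr_ge0 ?(ltW r0)// -EFinD lee_fin.
rewrite ler_pdivrMr// mulrDl mulVf ?gt_eqF//; exact: ltW.
Qed.

(** Shrinking a disc by r multiplies the parameter of y by 1 / r, that is, it acts on tanh of the
    distance. It becomes a factor on the distance itself only to first order, hence the hypothesis
    in terms of [th]. *)
Lemma lempert_localize G G' x y (r s t : R) : (0 < r <= 1) ->
  (forall phi, holomorphic_disc G phi -> phi 0 = x ->
    forall a, (cmod a < r) -> G' (phi a)) ->
  (lempert G x y < s%:E)%E -> (th s <= r * th t) -> (lempert G' x y <= t%:E)%E.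
Proof.
move=> /andP[r0 r1] GG' /lempert_lt[phi [a [pG p0 pa ac]]] st.
have pG' : holomorphic_disc G' (fun h => phi (rc r * h)).
  split=> b b1.
    by apply: (proj1 (disc_rescale _ pG)) => //; rewrite cmod_rc gtr0_norm.
  apply: (GG' _ pG p0); rewrite cmodM cmod_rc gtr0_norm//.
  by rewrite gtr_pMr.
apply: (@lempert_le _ _ (rc r^-1 * a) _ _ _ pG') => //.
- by rewrite mulr0.
- by rewrite mulrA [rc r * _]mulrC rcVK ?gt_eqF// mul1r.
- rewrite cmodM cmod_rc ger0_norm ?invr_ge0 ?(ltW r0)// ler_pdivrMl//.
  exact: ltW (lt_le_trans ac st).
Qed.

Lemma kob_ge0 G x y : (0 <= kobayashi G x y)%E.
Proof.
apply: ereal_sup_ubound; exists (fun _ _ => 0%E) => //; split.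
  by split=> // *; rewrite ?lexx ?ltry ?add0e.
by move=> *; exact: lempert_ge0.
Qed.

Lemma kob_refl G x : G x -> kobayashi G x x = 0%E.
Proof.
move=> Gx; apply/eqP; rewrite eq_le kob_ge0 andbT.
by apply: ge_ereal_sup => _ [d [[_ d0 _ _] _] <-]; rewrite d0.
Qed.

Lemma kob_sym G x y : G x -> G y -> kobayashi G x y = kobayashi G y x.
Proof.
move=> Gx Gy; congr ereal_sup; apply/seteqP; split=> _ [d dP <-]; exists d => //;
  by case: dP => -[_ _ ds _] _; rewrite ds.
Qed.

Lemma kob_triangle G x y z : G x -> G y -> G z ->
  (kobayashi G x z <= kobayashi G x y + kobayashi G y z)%E.
Proof.
move=> Gx Gy Gz; apply: ge_ereal_sup => _ [d dP <-].
have [[_ _ _ dt] _] := dP.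
apply: (le_trans (dt x y z Gx Gy Gz)); apply: leeD;
  by apply: ereal_sup_ubound; exists d.
Qed.

Lemma kob_le_lempert G x y : G x -> G y -> (kobayashi G x y <= lempert G x y)%E.
Proof. by move=> Gx Gy; apply: ge_ereal_sup => _ [d [_ dl] <-]; exact: dl. Qed.

Lemma kob_sub G G' x y : G' `<=` G -> G' x -> G' y ->
  (kobayashi G x y <= kobayashi G' x y)%E.
Proof.
move=> GG Gx Gy; apply: ge_ereal_sup => _ [d [[d1 d2 d3 d4] dl] <-].
apply: ereal_sup_ubound; exists d => //; split; first split.
- by move=> ? ? /GG ? /GG ?; exact: d1.
- by move=> ? /GG ?; exact: d2.
- by move=> ? ? /GG ? /GG ?; exact: d3.
- by move=> ? ? ? /GG ? /GG ? /GG ?; exact: d4.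
- move=> ? ? /GG ? /GG ?; apply: le_trans (lempert_sub _ _ GG); exact: dl.
Qed.

End Kobayashi.

(** * Unit speed curves *)

(** Continuous induction. The local hypothesis only concerns intervals that contain the point t, so
    first-order estimates at t are enough to verify it. *)
Lemma cousin {R : realType} (P : R -> R -> Prop) (a b : R) : a <= b ->
  (forall u v w, a <= u -> u <= v -> v <= w -> w <= b ->
     P u v -> P v w -> P u w) ->
  (forall t, a <= t <= b -> exists2 d : R, 0 < d &
     forall u w, a <= u -> u <= t -> t <= w -> w <= b -> w - u < d -> P u w) ->
  P a b.
Proof.
move=> ab Ptr Ploc.
pose S := [set t | a <= t <= b /\ P a t].
have Sa : S a.
  split; first by rewrite lexx.
  have [|d d0] := Ploc a; first by rewrite lexx.
  by apply=> //; rewrite subrr.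
have Sub : has_sup S by split; [exists a | exists b => t [/andP[]]].
have as_ : a <= sup S by exact: (ub_le_sup (proj2 Sub) Sa).
have sb : sup S <= b by apply: ge_sup; [exists a | move=> t [/andP[]]].
have [|d d0 hd] := Ploc (sup S); first by rewrite as_.
have [t [/andP[at_ tb] Pt] ts] := sup_adherent (divr_gt0 d0 (ltr0Sn R 1)) Sub.
have t_s : t <= sup S by apply: (ub_le_sup (proj2 Sub)); split=> //; apply/andP.
(* From a point t of S within d / 2 of [sup S] to w the span is less than d, so w belongs to S. This
   forces w = b, since otherwise w would exceed [sup S]. *)
pose w := Num.min b (sup S + d / 3).
have sw : sup S <= w by rewrite /w le_min sb /=; lra.
have wb : w <= b by rewrite /w ge_min lexx.
have wd : w <= sup S + d / 3 by rewrite /w ge_min lexx orbT.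
have Pw : P a w.
  apply: (Ptr a t w) => //; first exact: le_trans sw.
  apply: hd => //; lra.
have : w <= sup S.
  apply: (ub_le_sup (proj2 Sub)); split=> //.
  by rewrite wb andbT; exact: le_trans sw.
by move: Pw; rewrite /w; case: (leP b (sup S + d / 3)) => //; lra.
Qed.

Lemma th_near {R : realType} (e : R) : 0 < e -> exists2 d : R, 0 < d &
  forall t, `|t| < d -> `|th t - t| <= e * `|t|.
Proof.
move=> e0; exists (Num.min (4^-1) (e / 2)); first by rewrite lt_min divr_gt0// invr_gt0 ltr0n.
suff H t : 0 <= t -> t < Num.min (4^-1) (e / 2) -> `|th t - t| <= e * t.
  move=> t; have [t0|t0] := leP 0 t; first by rewrite ger0_norm//; exact: H.
  rewrite ltr0_norm// => /(H _ (ltW _)) -/(_ ltac:(by rewrite oppr_gt0)).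
  by rewrite thN -opprD normrN.
move=> t0; rewrite lt_min => /andP[t4 te].
have h1 : t - t ^+ 2 <= th t.
  apply: le_trans (th_lower t0); rewrite ler_pdivlMr; last lra.
  have := sqr_ge0 t; nra.
have h2 : th t <= t + 2 * t ^+ 2.
  apply: (le_trans (th_upper _)); first lra.
  rewrite ler_pdivrMr; last lra.
  have := sqr_ge0 t; nra.
have t2 := sqr_ge0 t; rewrite ler_norml; apply/andP; split; nra.
Qed.

Lemma normr_th {R : realType} (t : R) : `|th t| = th `|t|.
Proof.
have [t0|t0] := leP 0 t; first by rewrite !ger0_norm// th_ge0.
by rewrite !ltr0_norm ?thN// -oppr_gt0 -thN th_gt0 oppr_gt0.
Qed.

Lemma norm_comparable {R : realType} (b h f : R) : `|b - h| <= f * `|h| ->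
  f <= 2^-1 -> `|h| <= 2 * `|b| /\ `|b| <= 2 * `|h|.
Proof.
move=> hb f2; have h0 := normr_ge0 h.
have hf : `|b - h| <= 2^-1 * `|h| by apply: le_trans hb _; rewrite ler_wpM2r.
have h1 : `|h| <= `|b - h| + `|b|.
  by rewrite -[`|b - h|]normrN opprB; apply: le_trans (ler_normD _ _); rewrite subrK.
have h2 : `|b| <= `|b - h| + `|h|.
  by apply: le_trans (ler_normD _ _); rewrite subrK.
by split; lra.
Qed.

Lemma chord_arith {R : realType} (S1 Y X h b bh rho v e : R) :
  S1 <= h * X + rho * bh * v -> h * X <= h * e -> rho * bh * v <= e * h ->
  h * e <= 2 * b * e -> Y <= e * b -> 0 < e * b -> S1 + Y < b * (8 * e).
Proof. lra. Qed.

Section UnitSpeed.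
Context {R : realType} {n : nat}.
Implicit Types (u v w x y z : Cn R n) (phi psi : CC R -> Cn R n).
Implicit Types (G : set (Cn R n)) (g : R -> Cn R n).

(* Curves that are affine between finitely many times and have Kobayashi-Royden speed
   at most 1. The last condition only involves pairs containing the base point t0,
   so that it is stable under concatenation; it makes the inequality between the
   Kobayashi distance and the length elementary. *)
Definition unit_speed G (a b : R) g : Prop :=
 [/\ forall t, a <= t <= b -> G (g t),
  exists M : R, forall s t, a <= s <= b -> a <= t <= b ->
    nrm (g s - g t) <= M * `|s - t|,
  exists B : seq R, forall t, a < t < b -> t \notin B -> exists v,
    (exists2 d : R, 0 < d & forall s, `|s - t| < d ->
       g s = g t + rc (s - t) *: v) /\
    (kobayashi_royden G (g t) v <= 1)%E &
  forall t0, a <= t0 <= b -> exists2 d : R, 0 < d & forall t, a <= t <= b ->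
    `|t - t0| < d -> (lempert G (g t0) (g t) <= `|t - t0|%:E)%E].

Lemma us_restrict G (a b c d : R) g : a <= c -> d <= b -> unit_speed G a b g ->
  unit_speed G c d g.
Proof.
move=> ac db [h1 [M h2] [B h3] h4].
have sub t : c <= t <= d -> a <= t <= b by move=> /andP[? ?]; apply/andP; lra.
split.
- by move=> t /sub; exact: h1.
- by exists M => s t /sub hs /sub ht; exact: h2.
- exists B => t /andP[ct td]; apply: h3; apply/andP; lra.
- move=> t0 /sub /h4[e e0 he]; exists e => // t /sub; exact: he.
Qed.

Lemma us_point G (a : R) x : G x -> unit_speed G a a (fun=> x).
Proof.
move=> Gx; split.
- by [].
- by exists 0 => s t _ _; rewrite subrr nrm0 mul0r.
- exists [::] => t /andP[h1 h2]; have := lt_trans h1 h2; by rewrite ltxx.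
- move=> t0 _; exists 1 => // t _ _; apply: (le_trans (lempert_refl Gx)).
  by rewrite lee_fin.
Qed.

Lemma us_reparam G (a b a' b' c e : R) g : `|e| = 1 ->
  (forall t, a' <= t <= b' -> a <= e * t + c <= b) ->
  (forall t, a' < t < b' -> a < e * t + c < b) ->
  unit_speed G a b g -> unit_speed G a' b' (fun t => g (e * t + c)).
Proof.
move=> e1 H H' [h1 [M h2] [B h3] h4].
have E s t : `|e * s + c - (e * t + c)| = `|s - t|.
  by rewrite opprD addrACA subrr addr0 -mulrBr normrM e1 mul1r.
have ee : e * e = 1.
  by rewrite -expr2 -[LHS]real_normK ?num_real// e1 expr1n.
split.
- by move=> t /H; exact: h1.
- by exists M => s t /H hs /H ht; rewrite -(E s t); exact: h2.
- exists [seq e * (s - c) | s <- B] => t /H' ht tB.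
  have [|v [[d d0 hd] hv]] := h3 _ ht.
    apply: contra tB => tB; apply/mapP; exists (e * t + c) => //.
    by rewrite addrK mulrA ee mul1r.
  exists (rc e *: v); split.
    exists d => // s st; rewrite hd ?E// scalerA; congr (_ + _ *: _).
    by rewrite -rcM; congr (rc _); ring.
  have : (e == 1) || (e == - 1) by rewrite -sqrf_eq1 expr2 ee.
  move=> /orP[] /eqP e1'.
    by have -> : rc e *: v = v by rewrite e1' rc1 scale1r.
  have -> : rc e *: v = - v by rewrite e1' rcN rc1 scaleN1r.
  exact: kr_opp.
- move=> t0 /H /h4[d d0 hd]; exists d => // t /H ht tt.
  by rewrite -(E t t0); apply: hd => //; rewrite E.
Qed.

Lemma us_shift G (a b c : R) g : unit_speed G a b g ->
  unit_speed G (a + c) (b + c) (fun t => g (t - c)).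
Proof.
move=> H; have := @us_reparam G a b (a + c) (b + c) (- c) 1 g (normr1 _) _ _ H.
under [in X in _ -> _ -> X]eq_fun do rewrite mul1r.
by apply=> t; rewrite mul1r; lra.
Qed.

Lemma us_rev G (a b : R) g : unit_speed G a b g ->
  unit_speed G a b (fun t => g (a + b - t)).
Proof.
move=> H; have := @us_reparam G a b a b (a + b) (-1) g (normrN1 _) _ _ H.
under [in X in _ -> _ -> X]eq_fun do rewrite mulN1r addrC.
by apply=> t; rewrite mulN1r; lra.
Qed.

Lemma us_cat G (a b c : R) g1 g2 : a <= b -> b <= c ->
  unit_speed G a b g1 -> unit_speed G b c g2 -> g1 b = g2 b ->
  unit_speed G a c (fun t => if t <= b then g1 t else g2 t).
Proof.
move=> ab bc [h1 [M1 h2] [B1 h3] h4] [k1 [M2 k2] [B2 k3] k4] gb.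
split.
- move=> t /andP[at_ tc]; case: leP => tb; first by apply: h1; rewrite at_.
  by apply: k1; rewrite tc (ltW tb).
- pose M := `|M1| + `|M2|.
  have M10 := normr_ge0 M1; have M20 := normr_ge0 M2.
  have h2' s t : a <= s <= b -> a <= t <= b -> nrm (g1 s - g1 t) <= M * `|s - t|.
    move=> hs ht; apply: (le_trans (h2 _ _ hs ht)); rewrite ler_wpM2r// /M.
    by have := ler_norm M1; lra.
  have k2' s t : b <= s <= c -> b <= t <= c -> nrm (g2 s - g2 t) <= M * `|s - t|.
    move=> hs ht; apply: (le_trans (k2 _ _ hs ht)); rewrite ler_wpM2r// /M.
    by have := ler_norm M2; lra.
  have mix s t : a <= s <= b -> b <= t <= c -> nrm (g1 s - g2 t) <= M * `|s - t|.
    move=> /andP[as_ sb] /andP[bt tc].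
    apply: (le_trans (nrm_triangle (g1 b) _ _)).
    have := h2' s b; rewrite as_ sb ab lexx => /(_ erefl erefl) A1.
    have := k2' b t; rewrite bt tc bc lexx -gb => /(_ erefl erefl) A2.
    apply: (le_trans (lerD A1 A2)); rewrite -mulrDr.
    by rewrite !ler0_norm ?subr_le0 ?(le_trans sb bt)// ler_wpM2l ?addr_ge0//; lra.
  exists M => s t /andP[as_ sc] /andP[at_ tc].
  case: (leP s b) => sb; case: (leP t b) => tb.
  + by apply: h2'; apply/andP.
  + by apply: mix; apply/andP; split=> //; exact: ltW.
  + by rewrite nrmB distrC; apply: mix; apply/andP; split=> //; exact: ltW.
  + by apply: k2'; apply/andP; split=> //; exact: ltW.
- exists (b :: B1 ++ B2) => t /andP[at_ tc].
  rewrite inE mem_cat !negb_or => /and3P[tb tB1 tB2].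
  move: tb; rewrite neq_lt => /orP[tb|tb].
  + have [|v [[d d0 hd] hv]] := h3 t _ tB1; first by rewrite at_.
    exists v; rewrite (ltW tb); split=> //.
    exists (Num.min d (b - t)); first by rewrite lt_min d0 subr_gt0.
    move=> s; rewrite lt_min => /andP[sd sb].
    have -> : s <= b by move: sb; rewrite ltr_norml; lra.
    exact: hd.
  + have [|v [[d d0 hd] hv]] := k3 t _ tB2; first by rewrite tb.
    exists v; rewrite leNgt tb /=; split=> //.
    exists (Num.min d (t - b)); first by rewrite lt_min d0 subr_gt0.
    move=> s; rewrite lt_min => /andP[sd sb].
    rewrite leNgt; have -> /= : b < s by move: sb; rewrite ltr_norml; lra.
    exact: hd.
- move=> t0 /andP[at0 t0c].
  have [tb|tb|tb] := ltgtP t0 b.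
  + have [|d d0 hd] := h4 t0; first by rewrite at0 (ltW tb).
    exists (Num.min d (b - t0)); first by rewrite lt_min d0 subr_gt0.
    move=> t /andP[at_ tc]; rewrite lt_min => /andP[td tb'].
    have tb2 : t <= b by move: tb'; rewrite ltr_norml; lra.
    by rewrite tb2; apply: hd => //; rewrite at_.
  + have [|d d0 hd] := k4 t0; first by rewrite t0c (ltW tb).
    exists (Num.min d (t0 - b)); first by rewrite lt_min d0 subr_gt0.
    move=> t /andP[at_ tc]; rewrite lt_min => /andP[td tb'].
    have tb2 : b < t by move: tb'; rewrite ltr_norml; lra.
    by rewrite [t <= b]leNgt tb2 /=; apply: hd => //; rewrite tc (ltW tb2).
  + subst t0; have [|d d0 hd] := h4 b; first by rewrite ab lexx.
    have [|d' d'0 hd'] := k4 b; first by rewrite bc lexx.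
    exists (Num.min d d'); first by rewrite lt_min d0.
    move=> t /andP[at_ tc]; rewrite lt_min => /andP[td td'].
    case: (leP t b) => tb2; first by apply: hd => //; rewrite at_.
    by rewrite gb; apply: hd' => //; rewrite tc (ltW tb2).
Qed.

(** Around each time t0 the triangle inequality through [g t0] gives the bound on the intervals
    containing t0, which is what [cousin] asks for. *)
Lemma us_kob G (a b : R) g : unit_speed G a b g ->
  forall s t, a <= s -> s <= t -> t <= b ->
  (kobayashi G (g s) (g t) <= (t - s)%:E)%E.
Proof.
move=> [h1 _ _ h4] s t as_ st tb.
apply: (@cousin R (fun s t => (kobayashi G (g s) (g t) <= (t - s)%:E)%E)) => //.
- move=> u v w su uv vw wt Puv Pvw.
  apply: (le_trans (kob_triangle (y := g v) _ _ _)); try by apply: h1; apply/andP; lra.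
  by apply: (le_trans (leeD Puv Pvw)); rewrite -EFinD lee_fin; lra.
- move=> t0 /andP[st0 t0t].
  have [|d d0 hd] := h4 t0; first by apply/andP; lra.
  exists d => // u w su ut tw wt wud.
  have G0 : G (g t0) by apply: h1; apply/andP; lra.
  have Gu : G (g u) by apply: h1; apply/andP; lra.
  have Gw : G (g w) by apply: h1; apply/andP; lra.
  apply: (le_trans (kob_triangle (y := g t0) _ _ _)) => //.
  have hu : (kobayashi G (g u) (g t0) <= (t0 - u)%:E)%E.
    rewrite kob_sym//; apply: (le_trans (kob_le_lempert G0 Gu)).
    have := hd u; rewrite distrC ger0_norm ?subr_ge0//; apply; last lra.
    by apply/andP; lra.
  have hw : (kobayashi G (g t0) (g w) <= (w - t0)%:E)%E.
    apply: (le_trans (kob_le_lempert G0 Gw)).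
    have := hd w; rewrite ger0_norm ?subr_ge0//; apply; last lra.
    by apply/andP; lra.
  by apply: (le_trans (leeD hu hw)); rewrite -EFinD lee_fin; lra.
Qed.


(** tanh has derivative 1 at 0. Half of the error e goes to psi, half to the replacement of tanh t
    by t. *)
Lemma path_deriv psi v (e : R) : cderiv psi 0 v -> 0 < e ->
  exists2 d : R, 0 < d & forall t : R, `|t| < d ->
    nrm (psi (rc (th t)) - psi 0 - rc t *: v) <= e * `|t|.
Proof.
move=> pv e0; have v0 := nrm_ge0 v.
pose f := Num.min 1 (e / (2 * (nrm v + 1))).
have f0 : 0 < f by rewrite lt_min ltr01 divr_gt0// mulr_gt0// ltr_wpDl.
have f1 : f <= 1 by rewrite ge_min lexx.
have fe : f * (2 * (nrm v + 1)) <= e.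
  by rewrite -ler_pdivlMr ?mulr_gt0 ?ltr_wpDl// ge_min lexx orbT.
have [d1 d10 hd1] := pv (e / 4) ltac:(by rewrite divr_gt0).
have [d2 d20 hd2] := th_near f0.
exists (Num.min d2 (d1 / 2)); first by rewrite lt_min d20 divr_gt0.
move=> t; rewrite lt_min => /andP[td2 td1].
have t0 := normr_ge0 t.
have h2 := hd2 _ td2.
have h3 : `|th t| <= 2 * `|t|.
  have : `|th t| <= `|th t - t| + `|t|.
    by apply: le_trans (ler_normD _ _); rewrite subrK.
  nra.
have := hd1 (rc (th t)); rewrite cmod_rc add0r => h1.
have {}h1 := h1 ltac:(lra).
have -> : psi (rc (th t)) - psi 0 - rc t *: v =
   (psi (rc (th t)) - psi 0 - rc (th t) *: v) + rc (th t - t) *: v.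
  rewrite rcB.
  by apply/rowP => j; rewrite !mxE; ring.
apply: (le_trans (nrmD _ _)); rewrite nrmZ cmod_rc; nra.
Qed.

Lemma open_lempert G x (e : R) : open G -> G x -> 0 < e ->
  exists2 r : R, 0 < r & forall y, nrm (y - x) < r ->
    G y /\ (lempert G x y <= e%:E)%E.
Proof.
move=> Go Gx e0.
have cst : holomorphic_disc G (fun=> x).
  by split=> // a _; exact: derivable_cst.
(* With [rho] = 0 the perturbations of the constant disc are affine discs; y is placed at the
   parameter tanh e. *)
have [|d d0 hd] := disc_perturb (rho := 0) Go cst; first by rewrite lexx ltr01.
have b0 : 0 < th e by rewrite th_gt0.
have b1 := th_lt1 e.
exists (d * th e); first by rewrite mulr_gt0.
move=> y yx.
pose u := rc (th e)^-1 *: (y - x).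
have ud : nrm u < d.
  by rewrite nrmZ cmod_rc gtr0_norm ?invr_gt0// ltr_pdivrMl// mulrC.
have H := hd 0 u; rewrite nrm0 in H; have {}H := H d0 ud.
have E : x + 0 + rc (th e) *: u = y.
  by rewrite addr0 scalerA mulrC rcVK ?gt_eqF// scale1r addrC subrK.
split.
  rewrite -E; apply: (proj2 H (rc (th e))).
  by rewrite /unit_disc /= cmod_rc gtr0_norm.
apply: (lempert_le H _ E); first by rewrite addr0 scale0r addr0.
by rewrite cmod_rc gtr0_norm.
Qed.

(** The disc psi(rho a), translated to be centred at x, nearly passes through the target at a = b,
    and the linear term a c corrects it exactly. The slope c is small because h V' and psi(rho b) -
    psi(0) both equal h rho v up to an error of order e |h|. *)
Lemma lempert_perturb G psi (rho e f h b : R) x v (V' : Cn R n) :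
  0 < rho < 1 -> 0 < e -> 0 < f -> f <= 2^-1 -> f * (nrm v + 1) <= e ->
  h != 0 -> `|b| = th `|h| -> `|b - h| <= f * `|h| ->
  nrm (V' - rc rho *: v) <= e ->
  nrm (psi (rc rho * rc b) - psi 0 - (rc rho * rc b) *: v) <= e * `|b| ->
  (forall c, nrm c < 8 * e ->
    holomorphic_disc G (fun a => psi (rc rho * a) + (x - psi 0) + a *: c)) ->
  (lempert G x (x + rc h *: V') <= `|h|%:E)%E.
Proof.
move=> /andP[rho0 rho1] e0 f0 f2 fe h0 bth hb Vv hrb disc.
have v0 := nrm_ge0 v.
have habs : 0 < `|h| by rewrite normr_gt0.
have [hbl hbu] := norm_comparable hb f2.
have b0 : 0 < `|b| by rewrite bth th_gt0.
have bn0 : b != 0 by rewrite -normr_gt0.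
have [c cE] : exists c, c = rc b^-1 *: (rc h *: V' - (psi (rc rho * rc b) - psi 0)).
  by eexists.
have hc : nrm c < 8 * e.
  rewrite cE nrmZ cmod_rc normfV ltr_pdivrMl//.
  have -> : rc h *: V' - (psi (rc rho * rc b) - psi 0) =
     rc h *: (V' - rc rho *: v) + (rc rho * rc (h - b)) *: v
     - (psi (rc rho * rc b) - psi 0 - (rc rho * rc b) *: v).
    rewrite rcB; move: (psi _) (psi 0) => p1 p2.
    by apply/rowP => j; rewrite !mxE; ring.
  apply: (le_lt_trans (nrmD _ _)); rewrite nrmN.
  have A := nrmD (rc h *: (V' - rc rho *: v)) ((rc rho * rc (h - b)) *: v).
  rewrite !nrmZ cmodM !cmod_rc (gtr0_norm rho0) [`|h - b|]distrC in A.
  have A1 : `|h| * nrm (V' - rc rho *: v) <= `|h| * e by rewrite ler_pM2l.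
  have A2 : rho * `|b - h| * nrm v <= e * `|h|.
    apply: (@le_trans _ _ (`|b - h| * nrm v)).
      by rewrite ler_wpM2r// ler_piMl// ltW.
    apply: (le_trans (ler_wpM2r v0 hb)); apply: le_trans (ler_wpM2r (ltW habs) fe).
    by rewrite mulrAC ler_pM2r// ler_pM2l// lerDl.
  have A3 := ler_wpM2r (ltW e0) hbl.
  exact: (chord_arith A A1 A2 A3 hrb (mulr_gt0 e0 b0)).
have E : psi (rc rho * rc b) + (x - psi 0) + rc b *: c = x + rc h *: V'.
  have -> : rc b *: c = rc h *: V' - (psi (rc rho * rc b) - psi 0).
    by rewrite cE scalerA -rcM mulfV// rc1 scale1r.
  move: (psi _) (psi 0) => p1 p2.
  by apply/rowP => j; rewrite !mxE; ring.
apply: (lempert_le (disc c hc) _ E); last by rewrite cmod_rc bth.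
by rewrite mulr0 scale0r addr0 addrC subrK.
Qed.

(* The path [t |-> psi (tanh t)] is replaced by its chords around 0: only the
   complex derivative of psi at the single point 0 is used, hence neither the
   continuity of the derivative nor any Cauchy estimate is needed. *)
Lemma us_chord G psi (eta : R) : open G -> holomorphic_disc G psi -> 0 < eta ->
  exists2 d : R, 0 < d & forall u w : R, u <= 0 -> 0 <= w -> w - u < d ->
  forall a : R, exists g, [/\ unit_speed G a (a + (1 + eta) * (w - u)) g,
    g a = psi (rc (th u)) & g (a + (1 + eta) * (w - u)) = psi (rc (th w))].
Proof.
move=> Go pG eta0.
(* Running slower by the factor 1 + eta pays for shrinking the disc to the radius rho, and the
   shrinking provides room for perturbations. *)
pose rho := (1 + eta)^-1.
have eta1 : 0 < 1 + eta by lra.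
have rho0 : 0 < rho by rewrite invr_gt0.
have rho1 : rho < 1 by rewrite invf_lt1//; lra.
have [|D D0 hD] := @disc_perturb R n G psi rho Go pG; first by rewrite (ltW rho0).
have [v pv] : exists v, cderiv psi 0 v.
  by apply: (disc_cderiv pG); rewrite cmod0.
have v0 := nrm_ge0 v.
have [e [e0 eD]] : exists e, 0 < e /\ D = 8 * e.
  by exists (D / 8); rewrite divr_gt0// mulrC divfK// pnatr_eq0.
have [d1 d10 hd1] := path_deriv pv e0.
have [d2 d20 hd2] := pv e e0.
pose f := Num.min 2^-1 (e / (nrm v + 1)).
have f0 : 0 < f by rewrite lt_min invr_gt0 ltr0n divr_gt0// ltr_wpDl.
have f2 : f <= 2^-1 by rewrite ge_min lexx.
have fe : f * (nrm v + 1) <= e.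
  by rewrite -ler_pdivlMr ?ltr_wpDl// ge_min lexx orbT.
have [d3 d30 hd3] := th_near f0.
(* Both ends of the chord lie within (|v| + e) d4 of psi(0), hence the whole chord within three
   times this, which is less than D. *)
pose d4 := D / (3 * (nrm v + e) + 1).
have d40 : 0 < d4 by rewrite divr_gt0// ltr_wpDl// mulr_ge0// addr_ge0// ltW.
have d4D : d4 * (3 * (nrm v + e) + 1) = D.
  by rewrite divfK// gt_eqF// ltr_wpDl// mulr_ge0// addr_ge0// ltW.
exists (Num.min d1 d4); first by rewrite lt_min d10.
move=> u w u0 w0; rewrite lt_min => /andP[wu1 wu4] a.
pose q t := psi (rc (th t)).
have qG t : G (q t).
  by apply: (proj2 pG); rewrite /unit_disc /= cmod_rc normr_th th_lt1.
have [uw|uw] := eqVneq w u.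
  rewrite uw subrr mulr0 addr0; exists (fun=> q u); split=> //.
  exact: us_point.
have wu0 : 0 < w - u.
  by rewrite subr_gt0 lt_neqAle eq_sym uw (le_trans u0).
have hu := hd1 u; have hw := hd1 w.
rewrite ler0_norm// in hu; rewrite ger0_norm// in hw.
have {}hu : nrm (q u - psi 0 - rc u *: v) <= e * - u.
  by apply: hu; apply: le_lt_trans wu1; rewrite lerDr.
have {}hw : nrm (q w - psi 0 - rc w *: v) <= e * w.
  by apply: hw; apply: le_lt_trans wu1; rewrite lerDl oppr_ge0.
pose T := (1 + eta) * (w - u).
have T0 : 0 < T by rewrite mulr_gt0.
pose V' := rc T^-1 *: (q w - q u).
pose g t := q u + rc (t - a) *: V'.
have Vv : nrm (V' - rc rho *: v) <= e.
  have -> : V' - rc rho *: v =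
      rc T^-1 *: ((q w - psi 0 - rc w *: v) - (q u - psi 0 - rc u *: v)).
    have -> : rc rho = rc T^-1 * (rc w - rc u) :> CC R.
      rewrite -rcB -rcM; congr (rc _).
      by rewrite /T /rho; field; rewrite !gt_eqF.
    by apply/rowP => j; rewrite !mxE; ring.
  rewrite nrmZ cmod_rc gtr0_norm ?invr_gt0// ler_pdivrMl//.
  apply: (le_trans (nrmD _ _)); rewrite nrmN.
  apply: (le_trans (lerD hw hu)).
  have -> : e * w + e * - u = e * (w - u) by ring.
  by rewrite mulrC ler_pM2r// /T ler_pMl//; clear - eta0; lra.
have qu : nrm (q u - psi 0) <= (nrm v + e) * - u.
  rewrite -[q u - psi 0](subrK (rc u *: v)).
  apply: (le_trans (nrmD _ _)); rewrite nrmZ cmod_rc ler0_norm//.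
  by rewrite mulrDl [leLHS]addrC [-u * _]mulrC lerD2l.
have qw : nrm (q w - psi 0) <= (nrm v + e) * w.
  rewrite -[q w - psi 0](subrK (rc w *: v)).
  apply: (le_trans (nrmD _ _)); rewrite nrmZ cmod_rc ger0_norm//.
  by rewrite mulrDl [leLHS]addrC [w * _]mulrC lerD2l.
have gnear t : a <= t <= a + T -> nrm (g t - psi 0) < D.
  move=> /andP[at_ taT].
  have -> : g t - psi 0 = (q u - psi 0) + rc ((t - a) / T) *: ((q w - psi 0) - (q u - psi 0)).
    rewrite /g /V' scalerA -rcM.
    by apply/rowP => j; rewrite !mxE; ring.
  have s1 : 0 <= (t - a) / T <= 1.
    by rewrite divr_ge0 ?(ltW T0) ?subr_ge0//= ler_pdivrMr// mul1r lerBlDl.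
  apply: (le_lt_trans (nrmD _ _)); rewrite nrmZ cmod_rc ger0_norm; last by case/andP: s1.
  have h := nrmD (q w - psi 0) (- (q u - psi 0)); rewrite nrmN in h.
  have n0 := nrm_ge0 (q w - psi 0 - (q u - psi 0)).
  have n1 : (t - a) / T * nrm (q w - psi 0 - (q u - psi 0)) <=
     nrm (q w - psi 0 - (q u - psi 0)) by rewrite ler_piMl//; case/andP: s1.
  have A : (nrm v + e) * (w - u) < (nrm v + e) * d4 by rewrite ltr_pM2l// ltr_wpDl.
  have B : (nrm v + e) * (w - u) = (nrm v + e) * w + (nrm v + e) * - u by ring.
  have B1 : 0 <= (nrm v + e) * w by rewrite mulr_ge0// addr_ge0// ltW.
  have B2 : 0 <= (nrm v + e) * - u by rewrite mulr_ge0 ?oppr_ge0// addr_ge0// ltW.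
  have C : D = 3 * ((nrm v + e) * d4) + d4 by rewrite -d4D; ring.
  clear - A B B1 B2 C h n1 qu qw d40; lra.
have disc c t : a <= t <= a + T -> nrm c < D ->
    holomorphic_disc G (fun h => psi (rc rho * h) + (g t - psi 0) + h *: c).
  by move=> ht hc; apply: hD => //; exact: gnear.
have at0 t c : psi (rc rho * 0) + (g t - psi 0) + (0 : CC R) *: c = g t.
  by rewrite mulr0 scale0r addr0 addrC subrK.
have aff t s : g s = g t + rc (s - t) *: V'.
  rewrite /g -addrA -scalerDl -rcD.
  by congr (_ + rc _ *: _); ring.
exists g; rewrite -/T; split; last 2 first.
- by rewrite /g subrr scale0r addr0.
- rewrite /g [a + T]addrC addrK /V' scalerA mulrC rcVK ?gt_eqF//.
  by rewrite scale1r addrC subrK.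
split.
- move=> t ht; rewrite -(at0 t 0); apply: (proj2 (disc 0 t ht _)); first by rewrite nrm0.
  by rewrite /unit_disc /= cmod0.
- exists (nrm V') => s t _ _.
  by rewrite (aff t s) addrC addKr nrmZ cmod_rc mulrC.
- exists [::] => t /andP[at_ taT] _; exists V'; split; first by exists 1.
  have ht : a <= t <= a + T by rewrite !ltW.
  (* A linear term of slope V' - rho v gives the perturbed disc exactly the derivative V' at its
     centre, so the parameter 1 is admissible for the speed. *)
  have hc : nrm (V' - rc rho *: v) < D by apply: (le_lt_trans Vv); rewrite eD; clear - e0; lra.
  rewrite -[V' in X in (X <= _)%E]scale1r -[leRHS]/(1%:E) -(@cmod1 R).
  apply: (kr_le 1 (disc _ _ ht hc) (at0 _ _)).
  have := @cderiv_rescale_affine R n psi rho (V' - rc rho *: v) v (g t - psi 0) pv.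
  by rewrite [rc rho *: v + _]addrC subrK; apply; rewrite !ltW.
- move=> t0 ht0.
  exists (Num.min d3 (d2 / 2)); first by rewrite lt_min d30 divr_gt0.
  move=> t ht; rewrite lt_min; set h := t - t0 => /andP[h3 h2].
  have [h0|h0] := eqVneq h 0.
    have -> : t = t0 by apply/eqP; rewrite -subr_eq0 -/h h0.
    apply: (le_trans (lempert_refl _)); last by rewrite lee_fin.
    rewrite -(at0 t0 0); apply: (proj2 (disc 0 t0 ht0 _)); first by rewrite nrm0.
    by rewrite /unit_disc /= cmod0.
  rewrite (aff t0 t); apply: (@lempert_perturb G psi rho e f h (th h) (g t0) v V') => //.
  + by rewrite rho0.
  + by rewrite normr_th.
  + exact: hd3.
  + have hb : `|th h - h| <= f * `|h| by exact: hd3.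
    have [_ hbu] := norm_comparable hb f2.
    have := hd2 (rc rho * rc (th h)); rewrite add0r cmodM !cmod_rc (gtr0_norm rho0) => A.
    have B : rho * `|th h| <= `|th h| by rewrite ler_piMl// ltW.
    apply: (le_trans (A _)); last by rewrite ler_pM2l.
    by apply: (le_lt_trans B); clear - hbu h2; lra.
  + by move=> c; rewrite -eD; exact: disc.
Qed.

End UnitSpeed.

(** * Curves along discs, and the Kobayashi distance as an infimum over curves *)

Section Curves.
Context {R : realType} {n : nat}.
Implicit Types (u v w x y z : Cn R n) (phi psi : CC R -> Cn R n).
Implicit Types (G : set (Cn R n)) (g : R -> Cn R n).

Lemma us_cat_ends G (a b c : R) g1 g2 : a <= b -> b <= c ->
  unit_speed G a b g1 -> unit_speed G b c g2 -> g1 b = g2 b ->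
  exists g, [/\ unit_speed G a c g, g a = g1 a & g c = g2 c].
Proof.
move=> ab bc h1 h2 e; exists (fun t => if t <= b then g1 t else g2 t).
split; first exact: us_cat.
  by rewrite ab.
by case: leP => // cb; have -> : c = b by apply/eqP; rewrite eq_le cb.
Qed.

(** After a rotation [al] lies on the positive real axis. Chords are available only near the centre
    of a disc, so around each time t the disc is recentred at tanh t by a real Moebius map, and
    [cousin] glues the pieces. *)
Lemma us_disc G phi (al : CC R) (tau eta : R) : open G -> holomorphic_disc G phi ->
  0 <= tau -> 0 < eta -> cmod al = th tau ->
  exists g, [/\ unit_speed G 0 ((1 + eta) * tau) g, g 0 = phi 0 &
    g ((1 + eta) * tau) = phi al].
Proof.
move=> Go pG tau0 eta0 alt.
have [uu uu1 aluu] : exists2 uu : CC R, cmod uu = 1 & al = uu * rc (th tau).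
  have [t0|t0] := eqVneq (th tau) 0.
    exists 1; first exact: cmod1.
    by rewrite t0 rc0 mulr0; apply: cmod_eq0; rewrite alt.
  exists (al * rc (th tau)^-1).
    by rewrite cmodM cmod_rc alt ger0_norm ?invr_ge0 ?th_ge0// mulfV.
  by rewrite -mulrA rcVK// mulr1.
pose psi h := phi (uu * h).
have psiG : holomorphic_disc G psi by apply: disc_rescale; rewrite ?uu1.
pose q t := psi (rc (th t)).
have H : forall a, exists g, [/\ unit_speed G a (a + (1 + eta) * (tau - 0)) g,
    g a = q 0 & g (a + (1 + eta) * (tau - 0)) = q tau].
  (* The starting time a is universally quantified so that consecutive pieces can be placed one
     after the other. *)
  apply: (@cousin R (fun s t => forall a, exists g,
    [/\ unit_speed G a (a + (1 + eta) * (t - s)) g,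
    g a = q s & g (a + (1 + eta) * (t - s)) = q t])) => //.
  - move=> u v w _ uv vw _ Puv Pvw a.
    have [g1 [h1 h1a h1b]] := Puv a.
    have [g2 [h2 h2a h2b]] := Pvw (a + (1 + eta) * (v - u)).
    have E : a + (1 + eta) * (v - u) + (1 + eta) * (w - v) =
      a + (1 + eta) * (w - u) by ring.
    rewrite E in h2 h2b.
    have [|||g [hg ga gb]] := us_cat_ends _ _ h1 h2.
    + by rewrite lerDl mulr_ge0 ?subr_ge0// addr_ge0// ltW.
    + by rewrite -E lerDl mulr_ge0 ?subr_ge0// addr_ge0// ltW.
    + by rewrite h1b h2a.
    + by exists g; rewrite ga gb.
  - move=> t /andP[t0 tt].
    have c1 : `|th t| < 1 by rewrite ger0_norm ?th_ge0// th_lt1.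
    have psiG' := disc_mobius c1 psiG.
    have [d d0 hd] := us_chord Go psiG' eta0.
    exists d => // u w u0 ut tw wtau wud a.
    have [|||g [hg ga gb]] := hd (u - t) (w - t) _ _ _ a.
    + by rewrite subr_le0.
    + by rewrite subr_ge0.
    + by rewrite opprB addrA subrK.
    have E s : psi ((rc (th (s - t)) + rc (th t)) / (1 + rc (th t) * rc (th (s - t)))) = q s.
      rewrite /q; have [den] := thD t (s - t); rewrite [t + _]addrC subrK => ->.
      by rewrite rcM rcV rcD rcD rcM rc1.
    rewrite !E in ga gb; exists g.
    have F : w - t - (u - t) = w - u by ring.
    by rewrite F in hg gb.
have [g [hg ga gb]] := H 0.
rewrite add0r subr0 in hg gb; exists g; split=> //.
- by rewrite ga /q th0 rc0 /psi mulr0.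
- by rewrite gb /q /psi -aluu.
Qed.

Definition joined G x y (l : R) := 0 <= l /\
  exists g, [/\ unit_speed G 0 l g, g 0 = x & g l = y].

Lemma joined_refl G x : G x -> joined G x x 0.
Proof. by move=> Gx; split=> //; exists (fun=> x); split=> //; exact: us_point. Qed.

Lemma joined_sym G x y (l : R) : joined G x y l -> joined G y x l.
Proof.
move=> [l0 [g [hg g0 gl]]]; split=> //; exists (fun t => g (0 + l - t)); split.
- exact: us_rev.
- by rewrite add0r subr0.
- by rewrite add0r subrr.
Qed.

Lemma joined_trans G x y z (l m : R) : joined G x y l -> joined G y z m ->
  joined G x z (l + m).
Proof.
move=> [l0 [g [hg g0 gl]]] [m0 [f [hf f0 fm]]]; split; first by rewrite addr_ge0.
have hf' := us_shift l hf.
rewrite add0r addrC in hf'.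
have [|||k [hk k0 kl]] := us_cat_ends _ _ hg hf' => //.
- by rewrite lerDl.
- by rewrite gl subrr f0.
- exists k; split=> //; first by rewrite k0.
  by rewrite kl [l + m]addrC addrK.
Qed.

Lemma lempert_joined G x y (c : R) : open G -> (lempert G x y < c%:E)%E ->
  exists2 l : R, l < c & joined G x y l.
Proof.
move=> Go /lempert_lt[phi [a [pG p0 pa ac]]].
have [|t t0 ta] := @th_surj R (cmod a).
  by rewrite cmod_ge0 (lt_trans ac (th_lt1 c)).
have tc : t < c by rewrite -th_mono ta.
have [e e0 etc] : exists2 e : R, 0 < e & (1 + e) * t < c.
  exists ((c - t) / (2 * (t + 1))).
    by rewrite divr_gt0 ?subr_gt0// mulr_gt0// ltr_wpDl.
  have h : (c - t) / (2 * (t + 1)) * t <= (c - t) / 2.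
    rewrite invfM mulrA -mulrA ler_piMr ?divr_ge0 ?subr_ge0 ?(ltW tc)//.
    by rewrite mulrC ler_pdivrMr ?ltr_wpDl// mul1r lerDl.
  by rewrite mulrDl mul1r; lra.
exists ((1 + e) * t) => //; split.
  by rewrite mulr_ge0// addr_ge0// ltW.
have [g [hg g0 gl]] := us_disc Go pG t0 e0 (esym ta).
by exists g; rewrite g0 gl p0 pa.
Qed.

(** The set of points joined to x is open and closed in G, because every point of G is joined to all
    points close to it. *)
Lemma joined_connected G x y : is_domain G -> G x -> G y ->
  exists l, joined G x y l.
Proof.
move=> [_ Go Gc] Gx Gy.
pose B := [set z | G z /\ exists l, joined G x z l].
have near z : G z -> exists2 r : R, 0 < r & forall w, nrm (w - z) < r ->
    G w /\ exists l, joined G z w l.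
  move=> Gz; have [r r0 hr] := open_lempert Go Gz ltr01.
  exists r => // w wz; have [Gw lw] := hr _ wz; split=> //.
  have [|l _ hl] := @lempert_joined G z w 2 Go; last by exists l.
  by apply: (le_lt_trans lw); rewrite lte_fin ltr1n.
suff BG : B = G by have [_ [l hl]] : B y by [rewrite BG]; exists l.
have BG : B `<=` G by move=> z [].
apply: Gc.
- by exists x; split=> //; exists 0; exact: joined_refl.
- exists B; last by rewrite setIC; apply/esym/setIidPl.
  rewrite openE => z [Gz [l hl]]; apply/nbhs_nrmP.
  have [r r0 hr] := near z Gz; exists r => // w /hr[Gw [m hm]].
  by split=> //; exists (l + m); exact: joined_trans hl hm.
- exists (~` (G `\` B)); last first.
    apply/seteqP; split=> [z Bz|z [Gz]].
      by split; [exact: BG | move=> []].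
    by move=> nz; apply: contrapT => Bz; apply: nz.
  apply: open_closedC; rewrite openE => z [Gz nBz]; apply/nbhs_nrmP.
  have [r r0 hr] := near z Gz; exists r => // w /hr[Gw [m hm]].
  split=> // -[_ [l hl]]; apply: nBz; split=> //; exists (l + m).
  exact: joined_trans hl (joined_sym hm).
Qed.

Lemma joined_kob G x y (l : R) : joined G x y l -> (kobayashi G x y <= l%:E)%E.
Proof.
move=> [l0 [g [hg <- <-]]].
by have := us_kob hg (lexx 0) l0 (lexx l); rewrite subr0.
Qed.

Lemma kob_fin G x y : is_domain G -> G x -> G y -> kobayashi G x y \is a fin_num.
Proof.
move=> Gd Gx Gy; have [l /joined_kob h] := joined_connected Gd Gx Gy.
by rewrite ge0_fin_numE ?kob_ge0//; apply: le_lt_trans h (ltry _).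
Qed.

(* The infimum of the lengths of the unit speed curves joining two points is a
   pseudodistance below the Lempert function, hence below the Kobayashi
   distance. *)
Lemma kob_joined G x y (c : R) : is_domain G -> G x -> G y ->
  (kobayashi G x y < c%:E)%E -> exists2 l : R, l < c & joined G x y l.
Proof.
move=> Gd Gx Gy kc.
pose d z w := ereal_inf [set l%:E | l in [set l : R | joined G z w l]].
have d0 z w : (0 <= d z w)%E.
  by apply: le_ereal_inf_tmp => _ [l [l0 _] <-]; rewrite lee_fin.
have dk : (d x y <= kobayashi G x y)%E.
  apply: ereal_sup_ubound; exists d => //; split; first split.
  - move=> z w Gz Gw; rewrite d0 /=; have [l hl] := joined_connected Gd Gz Gw.
    by apply: (@le_lt_trans _ _ l%:E); [apply: ereal_inf_lbound; exists l | exact: ltry].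
  - move=> z Gz; apply/eqP; rewrite eq_le d0 andbT; apply: ereal_inf_lbound.
    by exists 0 => //; exact: joined_refl.
  - by move=> z w _ _; congr ereal_inf; apply/seteqP; split=> _ [l hl <-];
      exists l => //; exact: joined_sym.
  - move=> z w v Gz Gw Gv.
    have fin a b : G a -> G b -> d a b \is a fin_num.
      move=> Ga Gb; rewrite ge0_fin_numE//; have [l hl] := joined_connected Gd Ga Gb.
      by apply: (@le_lt_trans _ _ l%:E); [apply: ereal_inf_lbound; exists l | exact: ltry].
    apply/lee_addgt0Pr => e e0.
    have e2 : 0 < e / 2 by rewrite divr_gt0.
    have [_ [l hl <-] ll] := lb_ereal_inf_adherent e2 (fin _ _ Gz Gw).
    have [_ [m hm <-] mm] := lb_ereal_inf_adherent e2 (fin _ _ Gw Gv).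
    apply: (@le_trans _ _ (l + m)%:E).
      by apply: ereal_inf_lbound; exists (l + m) => //; exact: joined_trans hl hm.
    rewrite EFinD; apply: (le_trans (leeD (ltW ll) (ltW mm))).
    by rewrite addeACA -EFinD -splitr.
  - move=> z w Gz Gw; case E: (lempert G z w) => [r| |]; last 2 first.
    + by rewrite leey.
    + by have := lempert_ge0 G z w; rewrite E.
    apply/lee_addgt0Pr => e e0.
    have [|l le hl] := @lempert_joined G z w (r + e) (let: And3 _ o _ := Gd in o).
      by rewrite E lte_fin ltrDl.
    apply: (@le_trans _ _ l%:E); first by apply: ereal_inf_lbound; exists l.
    by rewrite -EFinD lee_fin ltW.
have /ereal_inf_lt[_ [l hl <-]] := le_lt_trans dk kc.
by rewrite lte_fin => lc; exists l.
Qed.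

Lemma open_kob G x (e : R) : open G -> G x -> 0 < e ->
  exists2 r : R, 0 < r & forall y, nrm (y - x) < r ->
    G y /\ (kobayashi G x y <= e%:E)%E.
Proof.
move=> Go Gx e0; have [r r0 hr] := open_lempert Go Gx e0.
exists r => // y /hr[Gy l]; split=> //; exact: le_trans (kob_le_lempert Gx Gy) l.
Qed.

End Curves.

(** * Hyperbolicity, exit times and connected components *)

Section Geometry.
Context {R : realType} {n : nat}.
Implicit Types (u v w x y z o p : Cn R n) (phi psi : CC R -> Cn R n).
Implicit Types (D G W K O : set (Cn R n)) (g : R -> Cn R n).

(* Meaningful only where the Kobayashi pseudodistance is finite, for instance on
   a domain: [fine] maps +oo to 0. *)
Definition kd G x y : R := fine (kobayashi G x y).

Lemma kdE G x y : is_domain G -> G x -> G y -> kobayashi G x y = (kd G x y)%:E.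
Proof. by move=> Gd Gx Gy; rewrite /kd fineK// kob_fin. Qed.

Lemma kd_ge0 G x y : 0 <= kd G x y.
Proof. by apply: fine_ge0; exact: kob_ge0. Qed.

Lemma kd_sym G x y : G x -> G y -> kd G x y = kd G y x.
Proof. by move=> Gx Gy; rewrite /kd kob_sym. Qed.

Lemma kd_triangle G x y z : is_domain G -> G x -> G y -> G z ->
  kd G x z <= kd G x y + kd G y z.
Proof.
move=> Gd Gx Gy Gz; rewrite -lee_fin EFinD -!kdE//.
exact: kob_triangle.
Qed.

Lemma kd_us G (a b : R) g : is_domain G -> unit_speed G a b g ->
  forall s t, a <= s -> s <= t -> t <= b -> kd G (g s) (g t) <= t - s.
Proof.
move=> Gd hg s t as_ st tb; rewrite -lee_fin -kdE//.
- exact: us_kob hg _ _ as_ st tb.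
- by case: hg => h _ _ _; apply: h; rewrite as_ (le_trans st).
- by case: hg => h _ _ _; apply: h; rewrite tb (le_trans as_).
Qed.

Lemma kd_joined G x y (c : R) : is_domain G -> G x -> G y -> kd G x y < c ->
  exists2 l : R, l < c & joined G x y l.
Proof. by move=> Gd Gx Gy kc; apply: kob_joined => //; rewrite kdE. Qed.

Lemma open_kd G x (e : R) : is_domain G -> G x -> 0 < e ->
  exists2 r : R, 0 < r & forall y, nrm (y - x) < r -> G y /\ kd G x y <= e.
Proof.
move=> Gd Gx e0; have Go : open G by case: Gd.
have [r r0 hr] := open_kob Go Gx e0.
by exists r => // y /hr[Gy]; rewrite kdE.
Qed.

(** The exit time is the infimum of the times outside W; as W is open, the curve is outside W at
    that time. The last clause is continuity from the left, which puts an exit point of a ball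
    exactly on its sphere. *)
Lemma us_first_exit G (a b : R) g W : open W -> a <= b -> unit_speed G a b g ->
  W (g a) -> ~ W (g b) -> exists t, [/\ a < t <= b, ~ W (g t),
    forall s, a <= s -> s < t -> W (g s) &
    forall r : R, 0 < r -> exists s, [/\ a <= s, s < t & nrm (g s - g t) < r]].
Proof.
move=> Wo ab [_ [M hM] _ _] Wa Wb.
pose T := [set t | a <= t <= b /\ ~ W (g t)].
have Ti : has_inf T.
  by split; [exists b; split=> //; rewrite ab lexx | exists a => t [/andP[]]].
have aT : a <= inf T.
  by apply: lb_le_inf; [exists b; split=> //; rewrite ab lexx | move=> t [/andP[]]].
have iT t : a <= t <= b -> ~ W (g t) -> inf T <= t.
  by move=> tab Wt; apply: (ge_inf (proj2 Ti)).
have Tb : inf T <= b by apply: iT => //; rewrite ab lexx.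
have hM' t s : a <= s <= b -> a <= t <= b -> nrm (g s - g t) <= (`|M| + 1) * `|s - t|.
  move=> hs ht; apply: (le_trans (hM _ _ hs ht)); rewrite ler_wpM2r//.
  by have := ler_norm M; lra.
have M1 : 0 < `|M| + 1 by rewrite ltr_wpDl.
have nW : ~ W (g (inf T)).
  move=> Wi; have [r r0 hr] := open_nrmP Wo Wi.
  have [t [tab Wt] ti] := inf_adherent (divr_gt0 r0 M1) Ti.
  have it : inf T <= t by exact: iT.
  apply: Wt; apply: hr; rewrite nrmB.
  apply: (le_lt_trans (hM' _ _ _ _)) => //; first by rewrite aT.
  rewrite [`|inf T - t|]ler0_norm ?subr_le0// opprB mulrC -ltr_pdivlMr//.
  by rewrite ltrBlDl.
have ai : a < inf T.
  by rewrite lt_neqAle aT andbT; apply/eqP => e; apply: nW; rewrite -e.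
exists (inf T); split=> //.
- by rewrite ai.
- move=> s as_ si; apply: contrapT => Ws.
  by have := iT s; rewrite as_ (le_trans (ltW si) Tb) leNgt si => /(_ erefl Ws).
- move=> r r0; pose s := Num.max a (inf T - r / (2 * (`|M| + 1))).
  have q0 : 0 < r / (2 * (`|M| + 1)) by rewrite divr_gt0// mulr_gt0.
  have as_ : a <= s by rewrite le_max lexx.
  have si : s < inf T by rewrite gt_max ai ltrBlDr ltrDl.
  have s2 : inf T - r / (2 * (`|M| + 1)) <= s by rewrite le_max lexx orbT.
  exists s; split=> //; apply: (le_lt_trans (hM' _ _ _ _)).
  + by rewrite as_ (le_trans (ltW si)).
  + by rewrite aT.
  + rewrite [`|s - inf T|]ltr0_norm ?subr_lt0// opprB mulrC.
    have h : inf T - s <= r / (2 * (`|M| + 1)) by rewrite lerBlDr -lerBlDl.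
    apply: (le_lt_trans (ler_wpM2r (ltW M1) h)).
    by rewrite invfM mulrA mulfVK ?gt_eqF//; lra.
Qed.

Lemma us_exit_sphere G (a b r : R) g o : a <= b -> unit_speed G a b g ->
  nrm (g a - o) < r -> r <= nrm (g b - o) ->
  exists t, [/\ a <= t <= b, nrm (g t - o) = r &
    forall s, a <= s -> s < t -> nrm (g s - o) < r].
Proof.
move=> ab hg ga gb.
have [||t [/andP[at_ tb] tr ts tlim]] := us_first_exit (@open_nrm_ball R n o r) ab hg.
- exact: ga.
- by apply/negP; rewrite -leNgt.
- exists t; split=> //; first by rewrite (ltW at_).
  apply/eqP; rewrite eq_le; apply/andP; split; last by move/negP: tr; rewrite -leNgt.
  apply/ler_addgt0Pr => e e0; have [s [as_ st sr]] := tlim e e0.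
  have := nrm_triangle (g s) (g t) o; have := ts s as_ st; rewrite /= [nrm (g t - g s)]nrmB.
  lra.
Qed.

(** Hyperbolicity gives positivity point by point, and compactness makes it uniform on a small
    sphere around o contained in G. A curve from o to a point outside the ball crosses this
    sphere. *)
Lemma hyperbolic_ball G o (r : R) : is_domain G -> hyperbolic G -> G o -> 0 < r ->
  exists2 e : R, 0 < e & forall y, G y -> r <= nrm (y - o) -> e <= kd G o y.
Proof.
move=> Gd [_ Gh] Go r0; have Gop : open G by case: Gd.
have [r1 r10 hr1] := open_nrmP Gop Go.
pose r2 := Num.min r (r1 / 2).
have r20 : 0 < r2 by rewrite lt_min r0 divr_gt0.
have r2r : r2 <= r by rewrite ge_min lexx.
have r21 : r2 < r1 by have : r2 <= r1 / 2 by [rewrite ge_min lexx orbT]; lra.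
have [e [e0 he]] : exists e : R, 0 < e /\ forall y, nrm (y - o) <= r2 ->
    r2 <= nrm (y - o) -> e <= kd G o y.
  have H : \forall e \near (0 : R)^'+, [set y | nrm (y - o) <= r2] `<=`
      (fun e : R => [set y | r2 <= nrm (y - o) -> e <= kd G o y]) e.
    have := @compact_nrm_ball R n o r2 => /compact_near_coveringP; apply.
    move=> y /= yr2; have [yr|yr] := ltP (nrm (y - o)) r2.
      exists ([set z | nrm (z - o) < r2], setT).
        split=> /=; last exact: filterT.
        by apply: open_nbhs_nbhs; split=> //; exact: open_nrm_ball.
      by move=> [z e] /= [zr _]; rewrite leNgt zr.
    have Gy : G y by apply: hr1; exact: le_lt_trans r21.
    have ky : 0 < kd G o y.
      rewrite lt_neqAle kd_ge0 andbT; apply/eqP => k0.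
      have oy : o = y by apply: Gh => //; rewrite kdE// -k0.
      by move: yr; rewrite -oy subrr nrm0 leNgt r20.
    have [d d0 hd] := open_kd Gd Gy (divr_gt0 ky (ltr0Sn R 1)).
    exists ([set z | nrm (z - y) < d], [set e | e < kd G o y / 2]).
      split=> /=; last by apply: nbhs_right_lt; rewrite divr_gt0.
      by apply/nbhs_nrmP; exists d.
    move=> [z e] /= [/hd[Gz kz] ez] _.
    have := kd_triangle Gd Go Gz Gy; rewrite (kd_sym Gz Gy); lra.
  apply: (@filter_ex _ (0 : R)^'+); near=> e; split.
    by near: e; exact: nbhs_right_gt.
  by near: e; exact: H.
exists e => // y Gy yr; rewrite leNgt; apply/negP => ky.
have [l le [l0 [g [hg g0 gl]]]] := kd_joined Gd Go Gy ky.
have [||t [/andP[t0 tl] tr _]] := @us_exit_sphere G 0 l r2 g o l0 hg.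
- by rewrite g0 subrr nrm0.
- by rewrite gl (le_trans r2r).
have := he (g t); rewrite tr lexx => /(_ erefl erefl).
have := kd_us Gd hg (lexx 0) t0 tl; rewrite g0 subr0; lra.
Unshelve. all: by end_near.
Qed.

(** Near each point of K the bound of [hyperbolic_ball] survives with half its constant, and
    compactness of K makes it uniform. *)
Lemma hyperbolic_compact G K O : is_domain G -> hyperbolic G -> compact K ->
  K `<=` G -> open O -> K `<=` O ->
  exists2 e : R, 0 < e & forall x y, K x -> G y -> ~ O y -> e <= kd G x y.
Proof.
move=> Gd Gh Kc KG Oo KO.
have [e [e0 he]] : exists e : R, 0 < e /\
    K `<=` [set x | G x -> forall y, G y -> ~ O y -> e <= kd G x y].
  have H : \forall e \near (0 : R)^'+, K `<=`
      (fun e : R => [set x | G x -> forall y, G y -> ~ O y -> e <= kd G x y]) e.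
    move: Kc => /compact_near_coveringP; apply.
    move=> x Kx /=; have Gx := KG _ Kx.
    have [r r0 hr] := open_nrmP Oo (KO _ Kx).
    have [e e0 he] := hyperbolic_ball Gd Gh Gx r0.
    have [d d0 hd] := open_kd Gd Gx (divr_gt0 e0 (ltr0Sn R 1)).
    exists ([set z | nrm (z - x) < d], [set f | f < e / 2]).
      split=> /=; last by apply: nbhs_right_lt; rewrite divr_gt0.
      by apply/nbhs_nrmP; exists d.
    move=> [z f] /= [/hd[Gz kz] ez] _ y Gy yO.
    have yr : r <= nrm (y - x) by rewrite leNgt; apply/negP => /hr.
    have := he y Gy yr.
    have := kd_triangle Gd Gx Gz Gy; lra.
  apply: (@filter_ex _ (0 : R)^'+); near=> e; split.
    by near: e; exact: nbhs_right_gt.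
  by near: e; exact: H.
by exists e => // x y Kx Gy yO; apply: (he x Kx) => //; exact: KG.
Unshelve. all: by end_near.
Qed.

Lemma kd_compact G K o : is_domain G -> compact K -> K `<=` G -> G o ->
  exists2 C : R, 0 <= C & forall x, K x -> kd G x o <= C.
Proof.
move=> Gd Kc KG Go.
have [C [C0 hC]] : exists C : R, 0 < C /\ K `<=` [set x | kd G x o <= C].
  have H : \forall C \near +oo, K `<=` (fun C : R => [set x | kd G x o <= C]) C.
    move: Kc => /compact_near_coveringP; apply.
    move=> x Kx /=; have Gx := KG _ Kx.
    have [d d0 hd] := open_kd Gd Gx ltr01.
    exists ([set z | nrm (z - x) < d], [set f | kd G x o + 1 < f]).
      split=> /=; last by apply: nbhs_pinfty_gt; rewrite num_real.
      by apply/nbhs_nrmP; exists d.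
    move=> [z f] /= [/hd[Gz kz] ez].
    by have := kd_triangle Gd Gz Gx Go; rewrite (kd_sym Gz Gx); lra.
  apply: (@filter_ex _ (pinfty_nbhs R)); near=> C; split.
    by near: C; apply: nbhs_pinfty_gt; rewrite num_real.
  by near: C; exact: H.
by exists C; [exact: ltW | exact: hC].
Unshelve. all: by end_near.
Qed.

Lemma path_component D (a b : R) (f : R -> Cn R n) :
  {within `[a, b], continuous f} -> (forall t, a <= t <= b -> D (f t)) ->
  forall s t, a <= s <= b -> a <= t <= b -> connected_component D (f s) (f t).
Proof.
move=> fc fD s t hs ht.
pose B := [set f r | r in `[a, b]%classic].
have Bs : B (f s) by exists s => //=; rewrite in_itv.
have Bt : B (f t) by exists t => //=; rewrite in_itv.
have BD : B `<=` D by move=> x [r /=]; rewrite in_itv /= => hr <-; exact: fD.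
have Bc : connected B.
  by apply: connected_continuous_connected fc; exact: segment_connected.
exact: (connected_component_max Bs BD Bc Bt).
Qed.

Lemma lipschitz_within (a b M : R) (f : R -> Cn R n) :
  (forall s t, a <= s <= b -> a <= t <= b -> nrm (f s - f t) <= M * `|s - t|) ->
  {within `[a, b], continuous f}.
Proof.
move=> hM; apply/subspace_continuousP => t /=; rewrite in_itv /= => ht.
move=> A /nbhs_nrmP[r r0 rA]; rewrite /nbhs /= /within /=.
have M1 : 0 < `|M| + 1 by rewrite ltr_wpDl.
apply/nbhs_ballP; exists (r / (`|M| + 1)) => /=; first by rewrite divr_gt0.
move=> s /= ts; rewrite in_itv /= => hs; apply: rA.
apply: (le_lt_trans (hM _ _ hs ht)).
move: ts; rewrite /ball /= distrC ltr_pdivlMr// mulrC => ts.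
apply: le_lt_trans ts; rewrite ler_wpM2r//.
by have := ler_norm M; lra.
Qed.

Lemma us_component G D (a b : R) g : unit_speed G a b g ->
  (forall t, a <= t <= b -> D (g t)) ->
  forall s t, a <= s <= b -> a <= t <= b -> connected_component D (g s) (g t).
Proof.
move=> [_ [M hM] _ _] gD; apply: path_component => //; exact: lipschitz_within hM.
Qed.

Lemma segment_component D x y : (forall t : R, 0 <= t <= 1 -> D (x + rc t *: (y - x))) ->
  connected_component D x y.
Proof.
move=> hD; have := @path_component D 0 1 (fun t => x + rc t *: (y - x)) _ hD 0 1.
rewrite rc0 rc1 scale0r addr0 scale1r [x + _]addrC subrK !lexx !ler01; apply=> //.
apply: (@lipschitz_within _ _ (nrm (y - x))) => s t _ _.
by rewrite opprD addrACA subrr add0r -scalerBl -rcB nrmZ cmod_rc mulrC.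
Qed.

Lemma disc_component G D phi (r : R) (a : CC R) : holomorphic_disc G phi -> r <= 1 ->
  (forall b, cmod b < r -> D (phi b)) -> cmod a < r ->
  connected_component D (phi 0) (phi a).
Proof.
move=> pG r1 pD ar.
have ha (t : R) : 0 <= t <= 1 -> cmod (rc t * a) < r.
  move=> /andP[t0 t1]; rewrite cmodM cmod_rc ger0_norm//.
  by apply: le_lt_trans ar; rewrite ler_piMl// cmod_ge0.
have := @path_component D 0 1 (fun t => phi (rc t * a)) _ _ 0 1.
rewrite rc0 rc1 mul0r mul1r !lexx !ler01; apply=> //; last first.
  by move=> t /ha; exact: pD.
apply/subspace_continuousP => t /=; rewrite in_itv /= => /ha tr.
have [v pv] := disc_cderiv pG (lt_le_trans tr r1).
move=> A /nbhs_nrmP[e e0 eA]; rewrite /nbhs /= /within /=.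
have [d d0 hd] := cderiv_cont pv e0.
have c1 : 0 < cmod a + 1 by rewrite ltr_wpDl// cmod_ge0.
apply/nbhs_ballP; exists (d / (cmod a + 1)) => /=; first by rewrite divr_gt0.
move=> s /= ts _; apply: eA; apply: hd.
rewrite -mulrBl -rcB cmodM cmod_rc.
move: ts; rewrite /ball /= distrC ltr_pdivlMr// => ts.
by apply: le_lt_trans ts; rewrite ler_wpM2l// lerDl.
Qed.

Lemma component_domain D x : open D -> D x -> is_domain (connected_component D x).
Proof.
move=> Do Dx; split.
- by exists x; exact: connected_component_refl.
- rewrite openE => y xy; apply/nbhs_nrmP.
  have Dy : D y by exact: connected_component_sub xy.
  have [r r0 hr] := open_nrmP Do Dy; exists r => // z zr.
  rewrite (same_connected_component xy); apply: segment_component => t /andP[t0 t1].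
  apply: hr; rewrite addrC addKr nrmZ cmod_rc ger0_norm//.
  by apply: le_lt_trans zr; rewrite ler_piMl// nrm_ge0.
- exact: component_connected.
Qed.

(** Compactness is applied to pairs of points of K. Near a pair the components of both points do not
    change, so the restriction to pairs in one component, where [kd] is meaningful, is locally
    stable. *)
Lemma kob_comp_compact D K : open D -> compact K -> K `<=` D ->
  exists2 C : R, 0 <= C & forall x y, K x -> K y -> connected_component D x y ->
    (kobayashi_comp D x y <= C%:E)%E.
Proof.
move=> Do Kc KD; pose Q (C : R) : set (Cn R n * Cn R n) := [set q |
  connected_component D q.1 q.2 -> kd (connected_component D q.1) q.1 q.2 <= C].
have [C [C0 hC]] : exists C : R, 0 < C /\ K `*` K `<=` Q C.
  have H : \forall C \near +oo, K `*` K `<=` Q C.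
    have := compact_setX Kc Kc => /compact_near_coveringP; apply.
    move=> [x y] /= [/KD Dx /KD Dy].
    have dx := component_domain Do Dx; have dy := component_domain Do Dy.
    have xx : connected_component D x x by exact: connected_component_refl.
    have yy : connected_component D y y by exact: connected_component_refl.
    have [d d0 hd] := open_kd dx xx ltr01.
    have [e e0 he] := open_kd dy yy ltr01.
    (* The 2 allows distance 1 for the displacement of each of the two points. *)
    exists ([set z | nrm (z - x) < d] `*` [set z | nrm (z - y) < e],
        [set f | kd (connected_component D x) x y + 2 < f]).
      split=> /=; last by apply: nbhs_pinfty_gt; rewrite num_real.
      exists ([set z | nrm (z - x) < d], [set z | nrm (z - y) < e]) => //.
      by split; apply/nbhs_nrmP; [exists d | exists e].
    move=> [[x' y'] f] /= [[/hd[xx' kx] /he[yy' ky]] hf] x'y'.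
    rewrite -(same_connected_component xx') in x'y' *.
    have exy : connected_component D x = connected_component D y.
      by rewrite (same_connected_component x'y') -(same_connected_component yy').
    rewrite -exy in yy' yy ky.
    have h1 := kd_triangle dx xx' xx x'y'.
    have h2 := kd_triangle dx xx yy x'y'.
    rewrite (kd_sym xx' xx) in h1; lra.
  apply: (@filter_ex _ (pinfty_nbhs R)); near=> C; split.
    by near: C; apply: nbhs_pinfty_gt; rewrite num_real.
  by near: C; exact: H.
exists C; first exact: ltW.
move=> x y Kx Ky xy; rewrite /kobayashi_comp kdE ?lee_fin//.
- exact: (hC (x, y)).
- by apply: component_domain => //; exact: KD.
- by apply: connected_component_refl; exact: KD.
Unshelve. all: by end_near.
Qed.

End Geometry.

(** * Unit speed curves are almost geodesics *)

Section Integral.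
Import HBNNSimple.
Context {R : realType}.
Implicit Types (s t : R).

(* [f] is not assumed to be measurable: the integral of a nonnegative function is
   then a lower integral, which is still monotone. *)
Lemma le_integral_off_finite (D : set R) (f : R -> \bar R) (h : R -> R) (B : seq R) :
  measurable D -> (forall t, D t -> (0 <= f t)%E) ->
  (forall t, D t -> 0 <= h t) -> measurable_fun D h ->
  (forall t, D t -> t \notin B -> (f t <= (h t)%:E)%E) ->
  (\int[lebesgue_measure]_(t in D) f t <= \int[lebesgue_measure]_(t in D) (h t)%:E)%E.
Proof.
move=> mD f0 h0 mh fh; rewrite ge0_integralE//.
apply: ge_ereal_sup => _ [k /= kf <-].
rewrite -integralT_nnsfun [leRHS]integral_mkcond.
apply: ae_ge0_le_integral => //.
- by move=> t _; rewrite lee_fin; exact: fun_ge0.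
- exact/measurable_EFinP.
- by move=> t _; rewrite patchE; case: ifPn => // /set_mem /h0; rewrite lee_fin.
- by apply/(measurable_restrictT _ mD)/measurable_EFinP.
- exists [set` B]; split.
  + apply: countable_measurable; first exact: measurable_set1.
    by apply: finite_set_countable; exact: finite_seq.
  + by apply: countable_lebesgue_measure0; apply: finite_set_countable; exact: finite_seq.
  + move=> t /= /not_implyP[_ kt]; apply: contrapT => /negP tB; apply: kt.
    apply: (le_trans (kf t)); rewrite !patchE; case: ifPn => // /set_mem Dt.
    exact: fh.
Qed.

(** A rational majorant of the exponential excess, centred at the time c of near closest approach to
    o. It has the explicit primitive [prof], so that its excess over 1 has integral at most A pi on
    any interval. *)
Definition dens (A c t : R) : R := 1 + A / (1 + (t - c) ^+ 2).
Definition prof (A c t : R) : R := t + A * atan (t - c).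

Lemma dens_ge1 (A c t : R) : 0 <= A -> 1 <= dens A c t.
Proof. by move=> A0; rewrite lerDl divr_ge0// addr_ge0 ?sqr_ge0. Qed.

Lemma is_derive_prof (A c t : R) : is_derive t 1 (prof A c) (dens A c t).
Proof.
have h : is_derive t 1 (fun s => atan (s - c)) ((1 + (t - c) ^+ 2)^-1).
  have h1 : is_derive t 1 (fun s : R => s - c) 1.
    by apply: is_derive_eq; rewrite oppr0 addr0.
  have := @is_derive1_comp R atan _ t _ _ (is_derive1_atan (t - c)) h1.
  by rewrite mulr1.
by apply: is_derive_eq.
Qed.

Lemma prof_le (A c s t : R) : 0 <= A -> prof A c t - prof A c s <= (t - s) + A * pi.
Proof.
move=> A0; rewrite /prof.
have h1 := atan_ltpi2 (t - c); have h2 := atan_gtNpi2 (s - c).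
have : A * (atan (t - c) - atan (s - c)) <= A * pi by rewrite ler_wpM2l//; lra.
lra.
Qed.

Lemma dens_continuous (A c : R) : continuous (dens A c).
Proof.
move=> t; apply: differentiable_continuous; apply/derivable1_diffP.
apply: derivableD => //; apply: derivableM => //; apply: derivableV => //.
by rewrite gt_eqF// ltr_pwDl// sqr_ge0.
Qed.

Lemma integral_dens (A c s t : R) : s <= t ->
  (\int[lebesgue_measure]_(r in `[s, t]) (dens A c r)%:E =
   (prof A c t - prof A c s)%:E)%E.
Proof.
rewrite le_eqVlt => /orP[/eqP ->|st]; first by rewrite subrr set_itv1 integral_set1.
have pd r : derivable (prof A c) r 1 by have [] := is_derive_prof A c r.
have pc r : {for r, continuous (prof A c)}.
  by apply: differentiable_continuous; apply/derivable1_diffP.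
rewrite (@continuous_FTC2 _ (dens A c) (prof A c)) ?EFinB//.
- by apply: continuous_subspaceT; exact: dens_continuous.
- split; first by move=> r _; exact: pd.
  + by apply: cvg_at_right_filter; exact: pc.
  + by apply: cvg_at_left_filter; exact: pc.
- by move=> r _; rewrite derive1E (@derive_val _ _ _ _ _ _ _ (is_derive_prof A c r)).
Qed.

End Integral.

Section Geodesic.
Context {R : realType} {n : nat}.
Implicit Types (u v w x y z o p : Cn R n) (g : R -> Cn R n).
Implicit Types (D G W K O : set (Cn R n)).

Lemma derive1_affine (f : R -> R) (t d m : R) : 0 < d ->
  (forall s, `|s - t| < d -> f s = f t + (s - t) * m) -> derive1 f t = m.
Proof.
move=> d0 hf; rewrite /derive1; apply: norm_lim_near_cst.
apply/nbhs_ballP; exists d => //= h; rewrite /ball /= sub0r normrN => hd h0.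
rewrite hf ?addrK// [f t + _]addrC addrK.
by rewrite -[_ *: _]/(h^-1 * (h * m)) mulrA mulVf// mul1r.
Qed.

Lemma velocity_affine g (t : R) v (d : R) : 0 < d ->
  (forall s, `|s - t| < d -> g s = g t + rc (s - t) *: v) -> velocity g t = v.
Proof.
move=> d0 hg; apply/rowP => j; rewrite mxE.
rewrite (@derive1_affine _ t d (complex.Re (v ord0 j)))//; last first.
  move=> s /hg ->; rewrite !mxE /rc; case: (g t ord0 j) (v ord0 j) => a b [e f] /=.
  by ring.
rewrite (@derive1_affine _ t d (complex.Im (v ord0 j)))//; last first.
  move=> s /hg ->; rewrite !mxE /rc; case: (g t ord0 j) (v ord0 j) => a b [e f] /=.
  by ring.
by case: (v ord0 j).
Qed.

Lemma us_absolutely_continuous G (a b : R) g : unit_speed G a b g ->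
  absolutely_continuous a b g.
Proof.
move=> [_ [M hM] _ _] e e0.
have M1 : 0 < `|M| + 1 by rewrite ltr_wpDl.
exists (e / (`|M| + 1)); first by rewrite divr_gt0.
move=> m s t st _ hs.
apply: (@le_lt_trans _ _ (\sum_(k < m) (`|M| + 1) * (t k - s k))).
  apply: ler_sum => k _; have [as_ skt tb] := st k.
  apply: (le_trans (enorm_le_nrm _)); apply: (le_trans (hM _ _ _ _)).
  - by rewrite tb (le_trans as_).
  - by rewrite as_ (le_trans skt).
  - rewrite ger0_norm ?subr_ge0// ler_wpM2r ?subr_ge0//.
    by have := ler_norm M; lra.
by rewrite -mulr_sumr mulrC -ltr_pdivlMr.
Qed.

Lemma us_kr_length G D (A c a b : R) g : 0 <= A -> unit_speed G a b g ->
  (forall t, a < t < b -> forall v, (kobayashi_royden G (g t) v <= 1)%E ->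
    (kobayashi_royden_comp D (g t) v <= (dens A c t)%:E)%E) ->
  forall s t, a <= s -> s <= t -> t <= b ->
  (kr_length D s t g <= (prof A c t - prof A c s)%:E)%E.
Proof.
move=> A0 [_ _ [B hB] _] hD s t as_ st tb; rewrite -integral_dens//.
(* At the end points [velocity] depends on values of g outside of [a, b], so they join the
   exceptional times. *)
apply: (@le_integral_off_finite _ _ _ _ [:: a, b & B]) => //.
- by move=> r _; exact: kr_ge0.
- by move=> r _; rewrite (le_trans ler01 (dens_ge1 _ _ _)).
- apply: subspace_continuous_measurable_fun => //.
  by apply: continuous_subspaceT; exact: dens_continuous.
- move=> r /=; rewrite ?in_itv /= => /andP[sr rt].
  rewrite !inE !negb_or => /and3P[ra rb rB].
  have hr : a < r < b.
    by rewrite !lt_neqAle [a == r]eq_sym ra rb (le_trans as_ sr) (le_trans rt tb).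
  have [v [[d d0 hd] hv]] := hB r hr rB.
  by rewrite (velocity_affine d0 hd); exact: hD.
Qed.

Lemma us_geodesic G D (lambda A c C a b : R) g : 0 <= A -> 1 <= lambda ->
  unit_speed G a b g -> (forall t, a <= t <= b -> D (g t)) ->
  (forall t, a < t < b -> forall v, (kobayashi_royden G (g t) v <= 1)%E ->
    (kobayashi_royden_comp D (g t) v <= (dens A c t)%:E)%E) ->
  (forall s t, a <= s -> s <= t -> t <= b ->
    ((prof A c t - prof A c s)%:E <= kobayashi_comp D (g s) (g t) + C%:E)%E) ->
  geodesic lambda C D a b g.
Proof.
move=> A0 l1 hg gD hD hk; split.
  split; first exact: us_absolutely_continuous hg.
  by move=> t; rewrite in_itv; exact: gD.
move=> s t as_ st tb; apply: (le_trans (us_kr_length A0 hg hD as_ st tb)).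
apply: (le_trans (hk s t as_ st tb)); rewrite leeD2r//.
by apply: lee_pemull; [exact: kob_ge0 | rewrite lee_fin].
Qed.

End Geodesic.

(** * Localization along almost geodesics *)

Section RealLemmas.
Context {R : realType}.

(** tanh h is h to first order, and r mu > 1 leaves room for a factor e strictly between 1 and r mu;
    then eta = e - 1. *)
Lemma th_ratio (r mu : R) : 0 < r -> 0 < mu -> 1 < r * mu ->
  exists2 d : R, 0 < d & exists2 eta : R, 0 < eta &
  forall h, 0 < h -> h < d -> th ((1 + eta) * h) <= r * th (mu * h).
Proof.
move=> r0 m0 rm; pose k := r * mu; pose e := (1 + k) / 2.
have k1 : 1 < k by [].
have e1 : 1 < e by rewrite /e; lra.
have ek : e < k by rewrite /e; lra.
have kE : k = r * mu by [].
clearbody e; clearbody k; have e0 : 0 < e by lra.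
have q0 : 0 < e * mu + k * e by rewrite addr_gt0// mulr_gt0//; lra.
have ke : 0 < k - e by rewrite subr_gt0.
exists (Num.min ((2 * e)^-1) ((k - e) / (e * mu + k * e))).
  by rewrite lt_min invr_gt0 divr_gt0 ?andbT ?mulr_gt0.
exists (e - 1); first by rewrite subr_gt0.
move=> h h0; rewrite lt_min => /andP[h1 h2].
rewrite addrCA subrr addr0.
have he : e * h < 2^-1.
  by rewrite mulrC -ltr_pdivlMr//; move: h1; rewrite invfM.
have {}h2 : h * (e * mu + k * e) < k - e by rewrite -ltr_pdivlMr.
have eh0 : 0 <= e * h by rewrite mulr_ge0// ltW.
have mh0 : 0 <= mu * h by rewrite mulr_ge0// ltW.
apply: (le_trans (th_upper _)); first by rewrite eh0.
apply: le_trans (ler_wpM2l (ltW r0) (th_lower mh0)).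
rewrite ler_pdivrMr; last lra.
rewrite mulrA mulrAC ler_pdivlMr; last lra.
have -> : e * h * (1 + mu * h) = h * (e + h * (e * mu)) by ring.
have -> : r * (mu * h) * (1 - e * h) = h * (k - h * (k * e)) by rewrite kE; ring.
rewrite ler_pM2l//; lra.
Qed.

Lemma prof_slope (A c t mu : R) : mu < dens A c t -> exists2 d : R, 0 < d &
  forall h, 0 < h -> h < d ->
    mu * h <= prof A c (t + h) - prof A c t /\
    mu * h <= prof A c t - prof A c (t - h).
Proof.
move=> md; have [pd pv] := is_derive_prof A c t.
have C : h^-1 *: ((prof A c \o shift t) (h *: 1) - prof A c t) @[h --> 0^'] --> dens A c t.
  by rewrite -pv; exact: pd.
have /nbhs_ballP[d /= d0 hd] : nbhs (0 : R) [set h : R | h != 0 ->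
    mu < h^-1 *: ((prof A c \o shift t) (h *: 1) - prof A c t)].
  exact: (cvgr_gt _ C _ md).
exists d => // h h0 hlt.
have bh : ball (0 : R) d h by rewrite /ball /= sub0r normrN gtr0_norm.
have bhN : ball (0 : R) d (- h) by rewrite /ball /= opprK add0r gtr0_norm.
have h1 := hd h bh (lt0r_neq0 h0).
have hN0 : - h != 0 by rewrite oppr_eq0 gt_eqF.
have h2 := hd (- h) bhN hN0.
have E1 : mu < h^-1 * (prof A c (t + h) - prof A c t).
  by move: h1 => /=; rewrite [_ *: 1]mulr1 [h + t]addrC.
have E2 : mu < (- h)^-1 * (prof A c (t - h) - prof A c t).
  by move: h2 => /=; rewrite [_ *: 1]mulr1 [- h + t]addrC.
split; first by move: E1; rewrite mulrC ltr_pdivlMr// => /ltW.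
by move: E2; rewrite invrN mulNr -mulrN opprB mulrC ltr_pdivlMr// => /ltW.
Qed.

(** exp |s| is at least (1 + |s| / 2)^2, which is at least (1 + s^2) / 4. *)
Lemma expR_le_rational (s : R) : expR (- `|s|) <= 4 / (1 + s ^+ 2).
Proof.
have s0 := normr_ge0 s.
have q0 : 0 < 1 + s ^+ 2 by rewrite ltr_pwDl// sqr_ge0.
have h1 := expR_ge1Dx (`|s| / 2).
have h2 : (1 + `|s| / 2) ^+ 2 <= expR `|s|.
  have -> : expR `|s| = expR (`|s| / 2) ^+ 2 by rewrite expr2 -expRD -splitr.
  by rewrite lerXn2r// nnegrE ?expR_ge0//; lra.
have h3 : `|s| ^+ 2 = s ^+ 2 by rewrite real_normK ?num_real.
rewrite expRN -[_^-1]mul1r ler_pdivrMr ?expR_gt0// mulrAC ler_pdivlMr// mul1r.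
nra.
Qed.

End RealLemmas.

Section Localization.
Context {R : realType} {n : nat}.
Implicit Types (u v w x y z o p : Cn R n) (g : R -> Cn R n).
Implicit Types (phi : CC R -> Cn R n).
Implicit Types (D G U V W K O : set (Cn R n)).

(* Up to the value of the constants, this says that for x in W the Lempert
   function from x to G `\` U is bounded away from 0 and at least kd G x o - C. *)
Definition escape_bound G U W o (B : R) := forall x phi (al : CC R),
  G x -> W x -> holomorphic_disc G phi -> phi 0 = x -> cmod al < 1 ->
  ~ U (phi al) -> 1 <= cmod al * (1 + B * expR (- (2 * kd G x o))).

(** Below this radius [escape_bound] excludes all points outside U; radial paths in the smaller disc
    then keep its image in the component of x. *)
Lemma escape_component G U W o (B : R) x phi (a : CC R) : 0 <= B ->
  escape_bound G U W o B -> G x -> W x ->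
  holomorphic_disc G phi -> phi 0 = x ->
  cmod a < (1 + B * expR (- (2 * kd G x o)))^-1 ->
  connected_component (G `&` U) x (phi a).
Proof.
move=> B0 esc Gx Wx pG p0.
set q := 1 + _.
have q1 : 1 <= q by rewrite lerDl mulr_ge0// expR_ge0.
have q0 : 0 < q by lra.
have qV : q^-1 <= 1 by rewrite invf_le1.
move=> aq; rewrite -p0; apply: (disc_component pG qV _ aq) => b bq.
have b1 := lt_le_trans bq qV; split; first exact: (proj2 pG).
apply: contrapT => Ub.
have := esc x phi b Gx Wx pG p0 b1 Ub.
rewrite -/q leNgt; move: bq; rewrite -[q^-1]mul1r ltr_pdivlMr// => ->.
by [].
Qed.

(** The arcs before s and after t take at least as much time as the distance between their ends, so
    the excess of the middle arc is at most the total excess. *)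
Lemma us_almost_geodesic G (L : R) g : is_domain G -> unit_speed G 0 L g ->
  L <= kd G (g 0) (g L) + 1 ->
  forall s t, 0 <= s -> s <= t -> t <= L -> t - s <= kd G (g s) (g t) + 1.
Proof.
move=> Gd hg hL s t s0 st tL.
have gG r : 0 <= r <= L -> G (g r) by case: hg => h _ _ _; exact: h.
have G0 : G (g 0) by apply: gG; apply/andP; lra.
have GL : G (g L) by apply: gG; apply/andP; lra.
have Gs : G (g s) by apply: gG; apply/andP; lra.
have Gt : G (g t) by apply: gG; apply/andP; lra.
have h1 := kd_us Gd hg (lexx 0) s0 (le_trans st tL).
have h2 := kd_us Gd hg (le_trans s0 st) tL (lexx L).
have h3 := kd_triangle Gd G0 Gs GL.
have h4 := kd_triangle Gd Gs Gt GL.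
lra.
Qed.

(** The 4 comes from [expR_le_rational] and exp 2 from the loss 2 in the growth of the distance to
    o. The summand 1 makes the comparison with [dens] strict, which leaves room for local
    estimates. *)
Definition profile_const (B : R) : R := 4 * B * expR 2 + 1.

(* [c] nearly minimizes the distance to [o] along the curve; away from [c] this
   distance grows at least like [`|t - c| / 2], whence an integrable density. *)
Lemma us_profile G (L B : R) g o : is_domain G -> G o -> 0 <= B -> 0 <= L ->
  unit_speed G 0 L g -> L <= kd G (g 0) (g L) + 1 ->
  exists c, forall t, 0 <= t <= L ->
    1 + B * expR (- (2 * kd G (g t) o)) < dens (profile_const B) c t.
Proof.
move=> Gd Go B0 L0 hg hL.
have gG r : 0 <= r <= L -> G (g r) by case: hg => h _ _ _; exact: h.
have al := us_almost_geodesic Gd hg hL.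
pose S := [set kd G (g t) o | t in [set t | 0 <= t <= L]].
have Si : has_inf S.
  split; first by exists (kd G (g 0) o); exists 0 => //=; rewrite lexx.
  by exists 0 => _ [t _ <-]; exact: kd_ge0.
have [_ [c hc <-] ck] := inf_adherent (ltr01 : 0 < 1 :> R) Si.
exists c => t ht; rewrite /dens ltrD2l.
have q0 : 0 < 1 + (t - c) ^+ 2 by rewrite ltr_pwDl// sqr_ge0.
have kt : inf S <= kd G (g t) o by apply: (ge_inf (proj2 Si)); exists t.
(* One unit is the excess of the curve, the other the error in the choice of c as a near minimum. *)
have key : `|t - c| - 2 <= 2 * kd G (g t) o.
  have Gt := gG _ ht; have Gc := gG _ hc.
  have tri := kd_triangle Gd Gt Go Gc.
  rewrite (kd_sym Go Gc) in tri.
  move: hc ht => /= /andP[c0 cL] /andP[t0 tL].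
  have [tc|/ltW tc] := leP t c.
    rewrite ler0_norm ?subr_le0// opprB.
    have := al t c t0 tc cL; lra.
  rewrite ger0_norm ?subr_ge0//.
  have := al c t c0 tc tL; rewrite (kd_sym Gc Gt); lra.
have h1 : expR (- (2 * kd G (g t) o)) <= expR 2 * (4 / (1 + (t - c) ^+ 2)).
  apply: (@le_trans _ _ (expR (2 + - `|t - c|))); first by rewrite ler_expR; lra.
  by rewrite expRD ler_pM2l ?expR_gt0//; exact: expR_le_rational.
apply: (le_lt_trans (ler_wpM2l B0 h1)).
rewrite /profile_const; apply: (@le_lt_trans _ _ (4 * B * expR 2 / (1 + (t - c) ^+ 2))).
  by rewrite le_eqVlt; apply/orP; left; apply/eqP; ring.
by rewrite [ltRHS]mulrDl mul1r ltrDl invr_gt0.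
Qed.

(** * Comparison of G and of its intersection with U along one curve *)

Section AlongCurve.
Variables (G U W : set (Cn R n)) (o : Cn R n) (B L c : R) (g : R -> Cn R n).
Let D := G `&` U.
Let A := profile_const B.
Hypotheses (Gd : is_domain G) (Uo : open U) (Go : G o) (B0 : 0 <= B).
Hypotheses (WU : W `<=` U) (esc : escape_bound G U W o B).
Hypotheses (hg : unit_speed G 0 L g) (hL : L <= kd G (g 0) (g L) + 1).
Hypothesis (hc : forall t, 0 <= t <= L ->
    1 + B * expR (- (2 * kd G (g t) o)) < dens A c t).

Let A0 : 0 <= A.
Proof. by rewrite /A /profile_const addr_ge0// !mulr_ge0// expR_ge0. Qed.

Let gG r : 0 <= r <= L -> G (g r).
Proof. by case: hg => h _ _ _; exact: h. Qed.

Let Do : open D.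
Proof. by apply: openI => //; case: Gd. Qed.

Lemma kr_along t v : 0 <= t <= L -> W (g t) ->
  (kobayashi_royden G (g t) v <= 1)%E ->
  (kobayashi_royden_comp D (g t) v <= (dens A c t)%:E)%E.
Proof.
move=> ht Wt kv; have Gt := gG ht.
set q := 1 + B * expR (- (2 * kd G (g t) o)).
have q1 : 1 <= q by rewrite lerDl mulr_ge0// expR_ge0.
have q0 : 0 < q by lra.
apply: (@le_trans _ _ (q^-1^-1)%:E); last by rewrite invrK lee_fin ltW// hc.
apply: (@kr_localize R n G) kv; first by rewrite invr_gt0 q0 invf_le1.
by move=> phi pG p0 a aq; apply: (escape_component B0 esc Gt Wt pG p0 aq).
Qed.

(** At a time r the Lempert function centred at [g r] is localized on both sides, and the slope of
    [prof] at r dominates the loss; [cousin] adds up these local estimates within a single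
    component. *)
Lemma kob_along s t : 0 <= s -> s <= t -> t <= L ->
  (forall r, s <= r <= t -> W (g r)) ->
  (kobayashi_comp D (g s) (g t) <= (prof A c t - prof A c s)%:E)%E.
Proof.
move=> s0 st tL gW.
have gr r : s <= r <= t -> 0 <= r <= L by move=> /andP[? ?]; apply/andP; lra.
have gD r : s <= r <= t -> D (g r).
  by move=> hr; split; [exact/gG/gr | exact/WU/gW].
have hst : s <= s <= t by rewrite lexx.
pose E := connected_component D (g s).
have Ed : is_domain E by apply: component_domain => //; exact: gD.
have gE r : s <= r <= t -> E (g r).
  move=> hr; apply: (us_component (us_restrict s0 tL hg)) => //.
rewrite /kobayashi_comp -/E.
pose P (a b : R) := (kobayashi E (g a) (g b) <= (prof A c b - prof A c a)%:E)%E.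
suff : P s t by [].
apply: (@cousin R P s t st); rewrite /P.
  move=> u v w su uv vw wt h1 h2.
  have hu : s <= u <= t by apply/andP; lra.
  have hv : s <= v <= t by apply/andP; lra.
  have hw : s <= w <= t by apply/andP; lra.
  apply: (le_trans (kob_triangle (gE u hu) (gE v hv) (gE w hw))).
  by apply: (le_trans (leeD h1 h2)); rewrite -EFinD lee_fin; lra.
move=> r hr; have Gr := gG (gr r hr); have Wr := gW r hr.
have Er := gE r hr.
have Ecr : connected_component D (g r) = E.
  by apply/esym; exact: same_connected_component.
set q := 1 + B * expR (- (2 * kd G (g r) o)).
have q1 : 1 <= q by rewrite lerDl mulr_ge0// expR_ge0.
have q0 : 0 < q by lra.
have qd : q < dens A c r by apply: hc; exact: gr.
(* mu > q absorbs the second-order terms of tanh, and mu < dens makes the increments of [prof] near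
   r at least mu times the time. *)
pose mu := (q + dens A c r) / 2.
have qmu : q < mu by rewrite /mu; lra.
have mud : mu < dens A c r by rewrite /mu; lra.
have mu0 : 0 < mu by lra.
have qV0 : 0 < q^-1 by rewrite invr_gt0.
have qm1 : 1 < q^-1 * mu by rewrite mulrC ltr_pdivlMr// mul1r.
have [d1 d10 [eta eta0 hth]] := th_ratio qV0 mu0 qm1.
have [d2 d20 hpr] := prof_slope mud.
have [_ _ _ hl] := hg; have [d3 d30 hd3] := hl r (gr r hr).
have near f : s <= f <= t -> f != r -> `|f - r| < Num.min d1 d3 ->
    (kobayashi E (g r) (g f) <= (mu * `|f - r|)%:E)%E.
  move=> hf fr; rewrite lt_min => /andP[fd1 fd3].
  have h0 : 0 < `|f - r| by rewrite normr_gt0 subr_eq0.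
  apply: (le_trans (kob_le_lempert Er (gE f hf))).
  apply: (@lempert_localize R n G E (g r) (g f) q^-1 ((1 + eta) * `|f - r|)).
  - by rewrite qV0 invf_le1.
  - move=> phi pG p0 a aq; rewrite -Ecr.
    exact: (escape_component B0 esc Gr Wr pG p0 aq).
  - apply: (le_lt_trans (hd3 f (gr f hf) fd3)).
    by rewrite lte_fin ltr_pMl// ltrDl.
  - exact: hth.
exists (Num.min (Num.min d1 d3) d2); first by rewrite !lt_min d10 d30.
move=> u w su ur rw wt; rewrite lt_min => /andP[wu1 wu2].
have hu : s <= u <= t by apply/andP; lra.
have hw : s <= w <= t by apply/andP; lra.
have left : (kobayashi E (g u) (g r) <= (prof A c r - prof A c u)%:E)%E.
  have [->|ur'] := eqVneq u r; first by rewrite subrr kob_refl.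
  have ru : 0 < r - u by rewrite subr_gt0 lt_neqAle ur'.
  rewrite kob_sym//; last exact: gE.
  apply: (le_trans (near u hu ur' _)).
    rewrite distrC gtr0_norm//; apply: le_lt_trans wu1; lra.
  rewrite lee_fin distrC gtr0_norm//.
  have [|_] := hpr (r - u) ru; first by apply: le_lt_trans wu2; lra.
  by rewrite opprB addrCA subrr addr0.
have right : (kobayashi E (g r) (g w) <= (prof A c w - prof A c r)%:E)%E.
  have [->|wr'] := eqVneq w r; first by rewrite subrr kob_refl.
  have rw0 : 0 < w - r by rewrite subr_gt0 lt_neqAle eq_sym wr'.
  apply: (le_trans (near w hw wr' _)).
    rewrite gtr0_norm//; apply: le_lt_trans wu1; lra.
  rewrite lee_fin gtr0_norm//.
  have [|+ _] := hpr (w - r) rw0; first by apply: le_lt_trans wu2; lra.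
  by rewrite addrCA subrr addr0.
apply: (le_trans (kob_triangle (gE u hu) Er (gE w hw))).
by apply: (le_trans (leeD left right)); rewrite -EFinD lee_fin; lra.
Qed.

Lemma kob_along_le s t : 0 <= s -> s <= t -> t <= L ->
  (forall r, s <= r <= t -> W (g r)) ->
  (kobayashi_comp D (g s) (g t) <= (t - s + A * pi)%:E)%E.
Proof.
move=> s0 st tL gW; apply: (le_trans (kob_along s0 st tL gW)).
by rewrite lee_fin; exact: prof_le.
Qed.

(** The time spent exceeds the distance of G by at most 1, the length in D exceeds the time by at
    most A pi, and the distance of G is at most that of the component of D. *)
Lemma geodesic_along (lambda b : R) : 1 <= lambda -> 0 <= b -> b <= L ->
  (forall r, 0 <= r <= b -> W (g r)) ->
  geodesic lambda (1 + A * pi) D 0 b g.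
Proof.
move=> l1 b0 bL gW.
have gr r : 0 <= r <= b -> 0 <= r <= L by move=> /andP[? ?]; apply/andP; lra.
have gD r : 0 <= r <= b -> D (g r).
  by move=> hr; split; [exact/gG/gr | exact/WU/gW].
have hgb := us_restrict (lexx 0) bL hg.
apply: (us_geodesic (c := c) A0 l1 hgb gD).
  move=> t /andP[t0 tb] v; have ht : 0 <= t <= b by rewrite !ltW.
  by apply: kr_along; [exact: gr | exact: gW].
move=> s t s0 st tb.
have hs : 0 <= s <= b by rewrite s0 (le_trans st).
have ht : 0 <= t <= b by rewrite tb (le_trans s0).
apply: (@le_trans _ _ (kobayashi G (g s) (g t) + (1 + A * pi)%:E)%E).
  rewrite (kdE Gd) -?EFinD ?lee_fin; try exact/gG/gr.
  have := prof_le c s t A0.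
  have := us_almost_geodesic Gd hg hL s0 st (le_trans tb bL).
  lra.
rewrite leeD2r//; apply: kob_sub.
- by move=> x /connected_component_sub[].
- by apply: connected_component_refl; exact: gD.
- exact: (us_component hgb gD hs ht).
Qed.

End AlongCurve.

(** The form in which visibility is used. The point of K is reached while the curve has not yet left
    W, so that the estimates valid on W apply up to it. *)
Definition trapped G V W K := forall (L : R) g, 0 <= L -> unit_speed G 0 L g ->
  L <= kd G (g 0) (g L) + 1 -> V (g 0) ->
  (forall t, 0 <= t <= L -> W (g t)) \/
  exists s, [/\ 0 <= s <= L, forall t, 0 <= t <= s -> W (g t) & K (g s)].

(** [trapped] is applied to an almost geodesic from z to w and to its reversal. The constant
    collects the excess 1 of this curve, the excess A pi of each of two arcs, and a bound C2 for
    distances in D between points of K in a common component. *)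
Lemma localization G U V W K o (B : R) : is_domain G -> open U -> G o -> 0 <= B ->
  W `<=` U -> escape_bound G U W o B -> compact K -> K `<=` G `&` U ->
  trapped G V W K ->
  exists2 C : R, 0 <= C & forall z w, (G `&` V) z -> (G `&` V) w ->
    connected_component (G `&` U) z w ->
    (kobayashi_comp (G `&` U) z w <= kobayashi G z w + C%:E)%E.
Proof.
move=> Gd Uo Go B0 WU esc Kc KD trap; set D := G `&` U.
have Do : open D by apply: openI => //; case: Gd.
have [C2 C20 hC2] := kob_comp_compact Do Kc KD.
have [A [A0 AE]] : exists A : R, 0 <= A /\ profile_const B = A.
  exists (profile_const B); split=> //.
  by rewrite /profile_const addr_ge0// !mulr_ge0// expR_ge0.
have pi0 := @pi_ge0 R.
have Api : 0 <= A * pi by rewrite mulr_ge0.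
exists (1 + 2 * (A * pi) + C2); first by rewrite !addr_ge0// mulr_ge0.
move=> z w [Gz Vz] [Gw Vw] zw.
have [l lk [l0 [g [hg g0 gl]]]] : exists2 l : R, l < kd G z w + 1 & joined G z w l.
  by apply: kd_joined => //; rewrite ltrDl.
have hL : l <= kd G (g 0) (g l) + 1 by rewrite g0 gl ltW.
have [c hc] := us_profile Gd Go B0 l0 hg hL.
have along s t : 0 <= s -> s <= t -> t <= l ->
    (forall r, s <= r <= t -> W (g r)) ->
    (kobayashi_comp D (g s) (g t) <= (t - s + A * pi)%:E)%E.
  by rewrite -AE; exact: (kob_along_le Gd Uo B0 WU esc hg hc).
have V0 : V (g 0) by rewrite g0.
rewrite (kdE Gd Gz Gw) -EFinD.
have [gW|[s [/andP[s0 sl] sW Ks]]] := trap l g l0 hg hL V0.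
  have := along 0 l (lexx 0) l0 (lexx l) gW; rewrite g0 gl subr0 => h.
  apply: (le_trans h); rewrite lee_fin; lra.
pose g' t := g (0 + l - t).
have hg' : unit_speed G 0 l g' by exact: us_rev.
have g'0 : g' 0 = w by rewrite /g' add0r subr0.
have g'l : g' l = z by rewrite /g' add0r subrr.
have hL' : l <= kd G (g' 0) (g' l) + 1 by rewrite g'0 g'l kd_sym// ltW.
have V0' : V (g' 0) by rewrite g'0.
have flip a t : 0 <= a -> l - a <= t <= l -> 0 <= l - t <= a /\ g t = g' (l - t).
  move=> a0 /andP[at_ tl]; split; first by apply/andP; lra.
  by rewrite /g' add0r opprB addrCA subrr addr0.
have [gW|[s' [/andP[s'0 s'l] s'W Ks']]] := trap l g' l0 hg' hL' V0'.
  have gW' t : 0 <= t <= l -> W (g t).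
    move=> ht; have [|h ->] := flip l t l0; first by rewrite subrr.
    exact: gW.
  have := along 0 l (lexx 0) l0 (lexx l) gW'; rewrite g0 gl subr0 => h.
  apply: (le_trans h); rewrite lee_fin; lra.
have sW' t : l - s' <= t <= l -> W (g t).
  by move=> ht; have [h ->] := flip s' t s'0 ht; exact: s'W.
have gs' : g' s' = g (l - s') by rewrite /g' add0r.
(* If the initial and the final arc overlap, the whole curve lies in W. *)
have [st|ts] := leP s (l - s'); last first.
  have gW t : 0 <= t <= l -> W (g t).
    move=> /andP[t0 tl]; have [ts'|ts'] := leP t s; first by apply: sW; rewrite t0.
    by apply: sW'; rewrite tl andbT; lra.
  have := along 0 l (lexx 0) l0 (lexx l) gW; rewrite g0 gl subr0 => h.
  apply: (le_trans h); rewrite lee_fin; lra.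
have Dz : D z by case: zw => C [Cz CD _] _; exact: CD.
have gD t : W (g t) -> 0 <= t <= l -> D (g t).
  by move=> Wt ht; split; [case: hg => h _ _ _; exact: h | exact: WU].
(* The two end arcs stay in D, and z and w share a component, so the two points of K lie in that
   component as well. *)
have zs : connected_component D z (g s).
  rewrite -g0; apply: (us_component (us_restrict (lexx 0) sl hg)).
  - by move=> t /andP[t0 ts]; apply: gD; [apply: sW; rewrite t0 | rewrite t0 (le_trans ts)].
  - by rewrite lexx.
  - by rewrite s0 lexx.
have ls0 : 0 <= l - s' by rewrite subr_ge0.
have wt : connected_component D w (g (l - s')).
  rewrite -gl; apply: (us_component (us_restrict ls0 (lexx l) hg)).
  - by move=> t /andP[t0 ts]; apply: gD; [apply: sW'; rewrite t0 | rewrite ts (le_trans ls0)].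
  - by rewrite lexx andbT; lra.
  - by rewrite lexx /=; lra.
have Ez := same_connected_component zs.
have Ew : connected_component D z = connected_component D w by exact: same_connected_component.
have Et := same_connected_component wt.
have zt : connected_component D z (g (l - s')) by rewrite Ew.
have zz : connected_component D z z by exact: connected_component_refl.
have h1 := along 0 s (lexx 0) s0 sl sW; rewrite g0 subr0 in h1.
have h3 := along (l - s') l ls0 _ (lexx l) sW'; rewrite gl in h3.
have {}h3 := h3 ltac:(lra).
have h2 : (kobayashi_comp D (g s) (g (l - s')%R) <= C2%:E)%E.
  by apply: hC2 => //; [rewrite -gs' | rewrite -Ez].
rewrite /kobayashi_comp -Ez in h2; rewrite /kobayashi_comp -Et -Ew in h3.
rewrite /kobayashi_comp in h1 *.
apply: (le_trans (kob_triangle zz zs zw)).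
apply: (le_trans (leeD h1 (kob_triangle zs zt zw))).
apply: (le_trans (leeD (lexx _) (leeD h2 h3))).
rewrite -!EFinD lee_fin; lra.
Qed.

End Localization.

(** * The two visibility hypotheses *)

Section Cases.
Context {R : realType} {n : nat}.
Implicit Types (u v w x y z o p : Cn R n) (g : R -> Cn R n).
Implicit Types (phi : CC R -> Cn R n).
Implicit Types (D G U V W K O : set (Cn R n)).

Lemma normr_coord_le x j : `|x ord0 j| <= `|x|.
Proof.
rewrite [leRHS]/Num.norm /= mx_normE -[leLHS]nngE num_le.
exact: (le_bigmax _ (fun i => `|x i.1 i.2|%:nng) (ord0, j)).
Qed.

Lemma bounded_nrmP A : bounded_set A <-> exists M : R, forall x : Cn R n, A x -> nrm x <= M.
Proof.
split=> [[M [Mr H]]|[M H]].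
- have hM := H (M + 1) ltac:(by rewrite ltrDl).
  exists (\sum_(j < n.+1) complex.Re (M + 1)) => x /hM /= xM.
  apply: ler_sum => j _.
  have := le_trans (normr_coord_le x j) xM.
  by rewrite normr_cmod lecE /= => /andP[].
- exists (real_complex R `|M|); split; first by rewrite complex_real.
  move=> b Mb x Ax /=; apply: le_trans (ltW Mb).
  have h : `|x| <= real_complex R (nrm x).
    rewrite [leLHS]/Num.norm /=.
    have [->|/mx_norm_neq0[[i j] ->]] := eqVneq (mx_norm x) 0.
      by rewrite ler0c nrm_ge0.
    by rewrite normr_cmod lecR ord1; exact: cmod_le_nrm.
  apply: (le_trans h); rewrite lecR; apply: (le_trans (H x Ax)); exact: ler_norm.
Qed.

Lemma bounded_ball p (r : R) : bounded_set [set y : Cn R n | nrm (y - p) < r].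
Proof.
apply/bounded_nrmP; exists (r + nrm p) => x /= xr.
by have := nrmD (x - p) p; rewrite subrK; lra.
Qed.

Lemma ball_neighbourhood p (r : R) : 0 < r ->
  neighbourhood p [set y : Cn R n | nrm (y - p) < r].
Proof. by move=> r0; split; [exact: open_nrm_ball | rewrite /= subrr nrm0]. Qed.

(** The case A = 0, in which [dens] is 1 and [prof] is the time itself. *)
Lemma geodesic_self G (lambda b L : R) g : is_domain G -> 1 <= lambda ->
  unit_speed G 0 L g -> L <= kd G (g 0) (g L) + 1 -> b <= L ->
  geodesic lambda 1 G 0 b g.
Proof.
move=> Gd l1 hg hL bL; have hgb := us_restrict (lexx 0) bL hg.
have gG t : 0 <= t <= b -> G (g t) by case: hgb => h _ _ _; exact: h.
have cc x : G x -> connected_component G x = G.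
  by move=> Gx; apply: connected_component_id => //; case: Gd.
apply: (us_geodesic (A := 0) (c := 0) (lexx 0) l1 hgb gG).
  move=> t /andP[t0 tb] v; rewrite /kobayashi_royden_comp cc; last by apply: gG; rewrite !ltW.
  by rewrite /dens mul0r addr0.
move=> s t s0 st tb.
have Gs : G (g s) by apply: gG; rewrite s0 (le_trans st).
have Gt : G (g t) by apply: gG; rewrite tb (le_trans s0).
rewrite /kobayashi_comp cc// kdE// -EFinD lee_fin /prof !mul0r !addr0.
exact: (us_almost_geodesic Gd hg hL s0 st (le_trans tb bL)).
Qed.

(* To be used with [D] equal to [G] in case (1) and to its intersection with [U] in
   case (2). *)
Lemma visible_trapped G D W (lambda eps : R) p : open W -> W p -> G `&` W `<=` D ->
  visible2 lambda eps D p ->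
  (forall L g, 0 <= L -> unit_speed G 0 L g -> L <= kd G (g 0) (g L) + 1 ->
    forall b, 0 <= b -> b <= L -> (forall t, 0 <= t <= b -> W (g t)) ->
    geodesic lambda eps D 0 b g) ->
  exists V K, [/\ neighbourhood p V, relatively_compact V W, compact K,
    K `<=` D `&` W & trapped G V W K].
Proof.
move=> Wo Wp GWD vis hgeo.
have [r r0 hr] := open_nrmP Wo Wp.
have r20 : 0 < r / 2 by rewrite divr_gt0.
(* The closed ball of radius r / 2 lies in W: a curve stopped on its sphere has left W0, as
   visibility requires, but is still in W. *)
pose W0 := [set y | nrm (y - p) < r / 2].
have W0o : open W0 by exact: open_nrm_ball.
have W0W y : nrm (y - p) <= r / 2 -> W y by move=> h; apply: hr; lra.
have [V [K [Vp [Vc VW0] Kc KD hvis]]] :=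
  vis W0 (ball_neighbourhood p r20) (bounded_ball p (r / 2)).
exists V, (K `&` [set y | nrm (y - p) <= r / 2]); split=> //.
- by split=> // y /VW0 /= yr; apply: W0W; exact: ltW.
- by apply: compact_closedI => //; exact: closed_nrm_ball.
- by move=> y [/KD Dy /W0W].
move=> L g L0 hg hL V0.
have gG t : 0 <= t <= L -> G (g t) by case: hg => h _ _ _; exact: h.
have W00 : nrm (g 0 - p) < r / 2 by apply: VW0; exact: subset_closure.
have [gW|/existsNP[t /not_implyP[ht Wt]]] :=
  pselect (forall t, 0 <= t <= L -> W (g t)); first by left.
right; have /andP[t0 tL] := ht.
have hgt := us_restrict (lexx 0) tL hg.
have tr : r / 2 <= nrm (g t - p) by rewrite leNgt; apply/negP => /ltW /W0W.
(* Cutting at the first time on the sphere keeps the curve in W, where [hgeo] applies. *)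
have [b [/andP[b0 bt] br bs]] := us_exit_sphere t0 hgt W00 tr.
have bL := le_trans bt tL.
have gr s : 0 <= s <= b -> nrm (g s - p) <= r / 2.
  move=> /andP[s0]; rewrite le_eqVlt => /orP[/eqP ->|sb]; first by rewrite br.
  by rewrite ltW// bs.
have gW s : 0 <= s <= b -> W (g s) by move=> /gr /W0W.
have [||s] := hvis 0 b g b0 (hgeo L g L0 hg hL b b0 bL gW).
- split=> //; apply: GWD; split; first by apply: gG; rewrite lexx.
  by apply: gW; rewrite lexx.
- split; last by rewrite /W0 /= br ltxx.
  apply: GWD; split; first by apply: gG; rewrite b0.
  by apply: gW; rewrite b0 lexx.
rewrite in_itv /= => /andP[s0 sb] Ks.
exists s; split; first by rewrite s0 (le_trans sb).
- by move=> a /andP[a0 as_]; apply: gW; rewrite a0 (le_trans as_).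
- by split=> //; apply: gr; rewrite s0.
Qed.

(** Once the modulus a is bounded below by c0, an additive bound on 1 - a becomes the multiplicative
    one of [escape_bound]. *)
Lemma escape_arith (a E M c0 : R) : 0 < c0 -> c0 <= a -> 0 <= E -> 0 <= M ->
  1 - a <= M * E -> 1 <= a * (1 + M / c0 * E).
Proof.
move=> c00 ca E0 M0 h.
have : M * E <= a * (M / c0 * E).
  have -> : a * (M / c0 * E) = (a / c0) * (M * E) by ring.
  by rewrite ler_peMl ?mulr_ge0// ler_pdivlMr// mul1r.
lra.
Qed.

Lemma kd_disc G phi (a : CC R) (t : R) : is_domain G -> holomorphic_disc G phi ->
  cmod a <= th t -> kd G (phi 0) (phi a) <= t.
Proof.
move=> Gd pG at_.
have a1 := le_lt_trans at_ (th_lt1 t).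
have G0 : G (phi 0) by apply: (proj2 pG); rewrite /unit_disc /= cmod0.
have Ga : G (phi a) by exact: (proj2 pG).
rewrite -lee_fin -kdE//; apply: (le_trans (kob_le_lempert G0 Ga)).
exact: (lempert_le pG).
Qed.

(** An almost geodesic from x to a point y outside U passes through K. The part after K gives the
    lower bound e, since K is at positive distance from the outside of U; the part before K gives
    k(x, o) - C. The first bounds the modulus of the exit parameter below, the second bounds its
    distance to 1. *)
Lemma escape_visible G U V K o : is_domain G -> hyperbolic G -> G o -> open U ->
  compact K -> K `<=` G `&` U -> trapped G V U K ->
  exists2 B : R, 0 <= B & escape_bound G U V o B.
Proof.
move=> Gd Gh Go Uo Kc KGU trap.
have KG : K `<=` G by move=> x /KGU[].
have KU : K `<=` U by move=> x /KGU[].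
have [e e0 he] := hyperbolic_compact Gd Gh Kc KG Uo KU.
have [C C0 hC] := kd_compact Gd Kc KG Go.
have sep x y : G x -> V x -> G y -> ~ U y -> e <= kd G x y /\ kd G x o - C <= kd G x y.
  move=> Gx Vx Gy Uy.
  suff H f : 0 < f -> f <= 1 -> e <= kd G x y + f /\ kd G x o - C <= kd G x y + f.
    split; apply/ler_addgt0Pr => f f0;
      have f1 : 0 < Num.min f 1 by [rewrite lt_min f0 ltr01];
      have [h1 h2] := H (Num.min f 1) f1 ltac:(by rewrite ge_min lexx orbT);
      have h3 : Num.min f 1 <= f by [rewrite ge_min lexx]; lra.
  move=> f0 f1.
  have [l lk [l0 [g [hg g0 gl]]]] : exists2 l : R, l < kd G x y + f & joined G x y l.
    by apply: kd_joined => //; rewrite ltrDl.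
  have hL : l <= kd G (g 0) (g l) + 1 by rewrite g0 gl; lra.
  have V0 : V (g 0) by rewrite g0.
  have [gU|[s [/andP[s0 sl] _ Ks]]] := trap l g l0 hg hL V0.
    by case: Uy; rewrite -gl; apply: gU; rewrite l0 lexx.
  have Gs := KG _ Ks.
  have h1 := kd_us Gd hg (lexx 0) s0 sl; rewrite g0 in h1.
  have h2 := kd_us Gd hg s0 sl (lexx l); rewrite gl in h2.
  have h3 := he _ _ Ks Gy Uy; have h4 := hC _ Ks.
  have h5 := kd_triangle Gd Gx Gs Go.
  have h6 := kd_ge0 G x (g s).
  split; lra.
pose M := 2 * expR (2 * C).
have M0 : 0 <= M by rewrite mulr_ge0// expR_ge0.
have te0 : 0 < th e by rewrite th_gt0.
exists (M / th e); first by rewrite divr_ge0// ltW.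
move=> x phi al Gx Vx pG p0 al1 Ual.
have [t t0 tal] : exists2 t : R, 0 <= t & th t = cmod al.
  by apply: th_surj; rewrite cmod_ge0.
have [h1 h2] := sep x (phi al) Gx Vx (proj2 pG _ al1) Ual.
have h3 : kd G x (phi al) <= t by rewrite -p0; apply: kd_disc => //; rewrite tal.
apply: escape_arith => //.
- by rewrite -tal th_mono_le (le_trans h1).
- rewrite /M -mulrA -expRD.
  have h4 : th t <= cmod al by rewrite tal.
  by apply: (le_trans (th_exp h4)); rewrite ler_pM2l// ler_expR; lra.
Qed.

(* This replaces the Schwarz lemma: a bounded disc, rescaled into a ball contained in
   G, does not expand distances from the disc to kd G, and kd G separates the
   centre of that ball from the points outside a smaller ball. *)
Lemma disc_equicontinuous G (M r : R) : is_domain G -> hyperbolic G -> 0 < M -> 0 < r ->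
  exists2 c : R, 0 < c < 1 & forall O phi x, holomorphic_disc O phi -> phi 0 = x ->
    (forall a, cmod a < 1 -> nrm (phi a - x) < M) ->
    forall a, cmod a < c -> nrm (phi a - x) < r.
Proof.
move=> Gd Gh M0 r0; have [[q Gq] Gop _] := Gd.
have [s s0 hs] := open_nrmP Gop Gq.
have sM0 : 0 < s / M by rewrite divr_gt0.
have [e e0 he] := hyperbolic_ball Gd Gh Gq (mulr_gt0 sM0 r0).
exists (th (e / 2)); first by rewrite th_lt1 th_gt0 divr_gt0.
move=> O phi x pO p0 pM a ac.
pose psi (h : CC R) := q + rc (s / M) *: (phi h - x).
have psiG : holomorphic_disc G psi.
  split=> b b1.
    apply: derivableD; first exact: derivable_cst.
    apply: derivableZ; apply: derivableB; last exact: derivable_cst.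
    exact: (proj1 pO).
  apply: hs; rewrite addrC addKr nrmZ cmod_rc gtr0_norm//.
  by have := pM b b1; rewrite -(ltr_pM2l sM0) divfK ?gt_eqF.
have p00 : psi 0 = q by rewrite /psi p0 subrr scaler0 addr0.
have kle : kd G q (psi a) <= e / 2 by rewrite -p00; apply: kd_disc => //; exact: ltW.
rewrite ltNge; apply/negP => ra.
have Ga : G (psi a) by apply: (proj2 psiG); exact: lt_trans ac (th_lt1 _).
have := he (psi a) Ga; rewrite {1}/psi addrC addKr nrmZ cmod_rc gtr0_norm//.
by rewrite ler_pM2l// => /(_ ra); lra.
Qed.

(** If G is unbounded, the Lempert function from points near p to far away points is at least some e
    > 0, so a disc centred near p stays bounded up to the radius tanh e. *)
Lemma hyperbolic_at_bounded G p : hyperbolic_at G p ->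
  exists (W : set (Cn R n)) (M rho : R), [/\ neighbourhood p W, 0 < M, 0 < rho <= 1 &
    forall phi, holomorphic_disc G phi -> W (phi 0) ->
      forall a, cmod a < rho -> nrm (phi a) < M].
Proof.
move=> [/bounded_nrmP[M hM]|[_ hlim]].
  exists setT, (`|M| + 1), 1; split.
  - by split => //; exact: openT.
  - by rewrite ltr_wpDl.
  - by rewrite ltr01 lexx.
  - move=> phi pG _ a a1; have := hM _ (proj2 pG a a1); have := ler_norm M; lra.
(* The lower limit is a supremum of infima over members of the filter, so one member A has a
   positive infimum. *)
move: hlim; rewrite limf_einfE => /ereal_sup_gt[_ [A [[P Q] [/= hP [M hQ]] PQA] <-] hinf].
have [e e0 he] : exists2 e : R, 0 < e & forall z w, A (z, w) -> (e%:E <= lempert G z w)%E.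
  have lb z w : A (z, w) -> (ereal_inf [set lempert G zw.1 zw.2 | zw in A] <= lempert G z w)%E.
    by move=> Azw; apply: ereal_inf_lbound; exists (z, w).
  case: (ereal_inf _) hinf lb => [r| |] //= r0 lb.
    by exists r; [rewrite -lte_fin | exact: lb].
  (* The infimum may be +oo, and then any positive bound serves. *)
  by exists 1 => // z w /lb; apply: le_trans; rewrite leey.
have [r r0 hr] : exists2 r : R, 0 < r & forall y, nrm (y - p) < r -> G y -> P y.
  by move: hP; rewrite /within /= => /nbhs_nrmP.
have te0 : 0 < th e by rewrite th_gt0.
exists [set y | nrm (y - p) < r], (n.+1%:R * `|M| + 1), (th e); split.
- exact: ball_neighbourhood.
- by rewrite ltr_wpDl// mulr_ge0.
- by rewrite te0 ltW// th_lt1.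
move=> phi pG Wp a ae.
have a1 := lt_trans ae (th_lt1 e).
have G0 : G (phi 0) by apply: (proj2 pG); rewrite /unit_disc /= cmod0.
have Ga : G (phi a) by exact: (proj2 pG).
have [Ma|Ma] := ltP M (enorm (phi a)); last first.
  apply: (@le_lt_trans _ _ (n.+1%:R * `|M|)); last by rewrite ltrDl.
  apply: (le_trans (nrm_le_enorm _)); rewrite ler_wpM2l//.
  by apply: (le_trans Ma); exact: ler_norm.
have : (e%:E <= lempert G (phi 0%R) (phi a))%E.
  apply: he; apply: PQA; split=> /=; first exact: hr.
  exact: hQ.
have [t t0 ta] : exists2 t : R, 0 <= t & th t = cmod a by apply: th_surj; rewrite cmod_ge0.
have ale : cmod a <= th t by rewrite ta.
move=> /le_trans /(_ (lempert_le pG erefl erefl ale)).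
by rewrite lee_fin -th_mono_le ta leNgt ae.
Qed.

(** On the radius [rho] discs centred near p are bounded, and by [disc_equicontinuous] they move by
    less than r on the fraction c of it; within 2 r of p they are still in U. *)
Lemma hyperbolic_at_safe G U p : is_domain G -> hyperbolic G -> hyperbolic_at G p ->
  neighbourhood p U -> exists (r c : R), [/\ 0 < r, 0 < c < 1,
    forall y, nrm (y - p) < r -> U y &
    forall phi, holomorphic_disc G phi -> nrm (phi 0 - p) < r ->
      forall a, cmod a < c -> U (phi a)].
Proof.
move=> Gd Gh /hyperbolic_at_bounded[W [M [rho [[Wo Wp] M0 /andP[rho0 rho1] hb]]]] [Uo Up].
have [r1 r10 hr1] := open_nrmP Uo Up.
have [r2 r20 hr2] := open_nrmP Wo Wp.
pose r := Num.min (r1 / 2) r2.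
have r0 : 0 < r by rewrite lt_min r20 divr_gt0.
have rr1 : r <= r1 / 2 by rewrite ge_min lexx.
have rr2 : r <= r2 by rewrite ge_min lexx orbT.
have [c /andP[c0 c1] hc] := disc_equicontinuous Gd Gh (addr_gt0 M0 M0) r0.
exists r, (rho * c); split=> //.
- by rewrite mulr_gt0//=; nra.
- by move=> y yr; apply: hr1; lra.
move=> phi pG pr a ac; apply: hr1.
have rhoC : cmod (rc rho) <= 1 by rewrite cmod_rc gtr0_norm.
have Wp0 : W (phi 0) by apply: hr2; exact: lt_le_trans rr2.
have bd b : cmod b < 1 -> nrm (phi (rc rho * b) - phi 0) < M + M.
  move=> b1; apply: (le_lt_trans (nrmD _ _)); rewrite nrmN ltrD//.
  - by apply: hb => //; rewrite cmodM cmod_rc gtr0_norm// gtr_pMr.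
  - by apply: hb => //; rewrite cmod0.
have p0' : phi (rc rho * 0) = phi 0 by rewrite mulr0.
have := hc G _ _ (disc_rescale rhoC pG) p0' bd (rc rho^-1 * a).
rewrite mulrA [rc rho * _]mulrC rcVK ?gt_eqF// mul1r cmodM cmod_rc gtr0_norm ?invr_gt0//.
rewrite ltr_pdivrMl// => /(_ ac) h.
have := nrm_triangle (phi 0) (phi a) p; lra.
Qed.

(** Almost geodesics of a component of D are almost geodesics for D, because all quantities for D
    are computed in that component. Visibility makes those from V to the outside of W meet K, which
    is at bounded distance from o. *)
Lemma visible_component_far G U W (lambda : R) o p : is_domain G -> open U -> G o -> 1 <= lambda ->
  neighbourhood p W -> bounded_set W -> W `<=` U ->
  visible2 lambda 1 (G `&` U) p ->
  exists (V : set (Cn R n)) (C : R), [/\ neighbourhood p V, V `<=` W, 0 <= C &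
    forall x y, G x -> V x -> connected_component (G `&` U) x y -> ~ W y ->
    kd G x o - C <= kd (connected_component (G `&` U) x) x y].
Proof.
move=> Gd Uo Go l1 Wp Wb WU vis; set D := G `&` U in vis *.
have Do : open D by apply: openI => //; case: Gd.
have [V [K [Vp [Vc VW] Kc KD hvis]]] := vis W Wp Wb.
have {}VW : V `<=` W by move=> x Vx; apply: VW; exact: subset_closure.
have KG : K `<=` G by move=> x /KD[].
have [C C0 hC] := kd_compact Gd Kc KG Go.
exists V, C; split=> // x y Gx Vx xy Wy.
have Dx : D x by split=> //; exact/WU/VW.
set E := connected_component D x in xy *.
have Ed : is_domain E by exact: component_domain.
have ED : E `<=` D by exact: connected_component_sub.
have Ex : E x by exact: connected_component_refl.
have EE z : E z -> connected_component D z = E.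
  by move=> Ez; apply/esym; exact: same_connected_component.
apply/ler_addgt0Pr => f f0.
have f1 : 0 < Num.min f 1 by rewrite lt_min f0 ltr01.
have f2 : Num.min f 1 <= f by rewrite ge_min lexx.
have f3 : Num.min f 1 <= 1 by rewrite ge_min lexx orbT.
have [l lk [l0 [g [hg g0 gl]]]] : exists2 l : R, l < kd E x y + Num.min f 1 & joined E x y l.
  by apply: kd_joined => //; rewrite ltrDl.
have gE t : 0 <= t <= l -> E (g t) by case: hg => h _ _ _; exact: h.
have hL : l <= kd E (g 0) (g l) + 1 by rewrite g0 gl; lra.
have geo : geodesic lambda 1 D 0 l g.
  apply: (us_geodesic (A := 0) (c := 0) (lexx 0) l1 hg).
  - by move=> t /gE /ED.
  - move=> t /andP[t0 tl] v; rewrite /kobayashi_royden_comp EE; last by apply: gE; rewrite !ltW.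
    by rewrite /dens mul0r addr0.
  - move=> s t s0 st tl.
    have Es : E (g s) by apply: gE; rewrite s0 (le_trans st).
    have Et : E (g t) by apply: gE; rewrite tl (le_trans s0).
    rewrite /kobayashi_comp EE// kdE// -EFinD lee_fin /prof !mul0r !addr0.
    exact: (us_almost_geodesic Ed hg hL s0 st tl).
have [||t] := hvis 0 l g l0 geo.
- by rewrite g0.
- by rewrite gl; split=> //; exact: ED.
rewrite in_itv /= => /andP[t0 tl] Kt.
have Et : E (g t) by apply: gE; rewrite t0.
have h1 := kd_us Ed hg (lexx 0) t0 tl; rewrite g0 subr0 in h1.
have h2 : kd G x (g t) <= kd E x (g t).
  rewrite -lee_fin -!kdE//; last exact: KG.
  by apply: kob_sub => //; move=> z /ED[].
have h3 := hC _ Kt; have h4 := kd_triangle Gd Gx (KG _ Kt) Go.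
lra.
Qed.

(** Here a is the modulus of a point sent outside U, barely larger than the exit radius Rr. The
    point t is moved inwards by little enough that (a - t) / (1 - t a), the pseudohyperbolic
    distance, stays below c, but by enough to lie inside the exit radius by a fixed proportion of 1
    - Rr. *)
Lemma near_exit_arith (c a Rr t : R) : 0 < c -> c < 1 -> c <= Rr -> Rr < 1 -> Rr <= a ->
  a < Rr + c * (1 - Rr) / 8 -> t = a - c * (1 - a ^+ 2) / 2 ->
  [/\ 0 <= t, t < a, a < 1, a - t < c * (1 - t * a) & c * (1 - Rr) / 4 <= 1 - t / Rr].
Proof.
move=> c0 c1 cR R1 Ra aR tE.
have R0 : 0 < Rr by lra.
have q0 : 0 < c * (1 - Rr) by rewrite mulr_gt0 ?subr_gt0.
have q1 : c * (1 - Rr) < 1 - Rr by rewrite gtr_pMl// subr_gt0.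
have a1 : a < 1 by lra.
have a0 : 0 < a by lra.
have a2 : a ^+ 2 < a by rewrite expr2 gtr_pMl.
have p0 : 0 < c * (1 - a ^+ 2) by rewrite mulr_gt0// subr_gt0; lra.
have ta : t < a by rewrite tE; lra.
have p1 : c * (1 - a ^+ 2) <= c by rewrite ger_pMr// gerBl sqr_ge0.
have t0 : 0 <= t by rewrite tE; lra.
split=> //.
- have taa : t * a < a ^+ 2 by rewrite expr2 ltr_pM2r.
  have : c * (1 - a ^+ 2) < c * (1 - t * a) by rewrite ltr_pM2l//; lra.
  rewrite tE; lra.
- have h1 : c * (1 - a) <= c * (1 - a ^+ 2) by rewrite ler_pM2l//; lra.
  have h2 : c * (1 - a) >= c * (1 - Rr) - c * (c * (1 - Rr) / 8).
    by rewrite -mulrBr ler_pM2l//; lra.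
  have h3 : c * (c * (1 - Rr) / 8) <= c * (1 - Rr) / 8 by rewrite ger_pMl ?divr_gt0// ltW.
  have h4 : t <= Rr - c * (1 - Rr) / 4 by rewrite tE; lra.
  have h5 : t / Rr <= 1 - c * (1 - Rr) / 4; last lra.
  rewrite ler_pdivrMr//.
  have : c * (1 - Rr) / 4 * Rr <= c * (1 - Rr) / 4 by rewrite ger_pMr ?divr_gt0// ltW.
  lra.
Qed.

(* Let r = inf S be the radius of the largest disc that phi maps into U. Discs
   centred in W stay in U up to the radius c, so phi leaves W already at a point
   zeta with 1 - |zeta| / r at least of the order of 1 - r; on the other hand
   artanh (|zeta| / r) is at least the distance in G `&` U from phi 0 to the outside
   of W. *)
Lemma escape_local G U W V o (c C : R) : is_domain G -> open U ->
  0 < c < 1 -> W `<=` U -> V `<=` W -> 0 <= C ->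
  (forall phi, holomorphic_disc G phi -> W (phi 0) ->
      forall a, cmod a < c -> U (phi a)) ->
  (forall x y, G x -> V x -> connected_component (G `&` U) x y -> ~ W y ->
    kd G x o - C <= kd (connected_component (G `&` U) x) x y) ->
  exists2 B : R, 0 <= B & escape_bound G U V o B.
Proof.
move=> Gd Uo /andP[c0 c1] WU VW C0 safe far; set D := G `&` U in far *.
have Do : open D by apply: openI => //; case: Gd.
(* From c (1 - inf S) / 4 <= 1 - t / inf S <= 2 exp (- 2 tau) with tau >= k(x, o) - C. *)
pose M := 8 / c * expR (2 * C).
have M0 : 0 <= M by rewrite mulr_ge0 ?expR_ge0// divr_ge0// ltW.
exists (M / c); first by rewrite divr_ge0// ltW.
move=> x phi al Gx Vx pG p0 al1 Ual.
pose S := [set r : R | exists a : CC R, [/\ cmod a = r, r < 1 & ~ U (phi a)]].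
have Sal : S (cmod al) by exists al.
have Wx : W (phi 0) by rewrite p0; exact: VW.
have cS : lbound S c.
  move=> r [a [ar r1 Ua]]; rewrite leNgt; apply/negP => rc_; apply: Ua.
  by apply: safe => //; rewrite ar.
have Si : has_inf S by split; [exists (cmod al) | exists c].
have cR : c <= inf S by apply: lb_le_inf => //; exists (cmod al).
have Ral : inf S <= cmod al by exact: (ge_inf (proj2 Si)).
have R1 : inf S < 1 by exact: le_lt_trans al1.
have R0 : 0 < inf S by exact: lt_le_trans cR.
have inU b : cmod b < inf S -> U (phi b).
  move=> bR; apply: contrapT => Ub.
  suff : inf S <= cmod b by rewrite leNgt bR.
  by apply: (ge_inf (proj2 Si)); exists b; split=> //; exact: lt_trans R1.
have d0 : 0 < c * (1 - inf S) / 8 by rewrite divr_gt0// mulr_gt0// subr_gt0.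
have [_ [b [<- b1 Ub]] bR] := inf_adherent d0 Si.
have Rb : inf S <= cmod b by apply: (ge_inf (proj2 Si)); exists b.
pose t := cmod b - c * (1 - cmod b ^+ 2) / 2.
have [t0 tb _ tc tR] := near_exit_arith c0 c1 cR R1 Rb bR (erefl t).
have b0 : 0 < cmod b by lra.
have t1 : `|t| < 1 by rewrite ger0_norm//; lra.
have [uu uu1 bE] : exists2 uu : CC R, cmod uu = 1 & b = uu * rc (cmod b).
  exists (b * rc (cmod b)^-1).
    by rewrite cmodM cmod_rc gtr0_norm ?invr_gt0// mulfV// gt_eqF.
  by rewrite -mulrA rcVK ?gt_eqF// mulr1.
have uu1' : cmod uu <= 1 by rewrite uu1.
have recG := disc_mobius t1 (disc_rescale uu1' pG).
set zeta := uu * rc t.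
have zt : cmod zeta = t by rewrite cmodM uu1 mul1r cmod_rc ger0_norm.
(* Otherwise the disc recentred at zeta would stay in U up to the radius c, which covers b: its
   parameter there is beta < c. *)
have Wz : ~ W (phi zeta).
  move=> Wz; apply: Ub.
  pose beta := (cmod b - t) / (1 - t * cmod b).
  have den : 0 < 1 - t * cmod b by nra.
  have betac : cmod (rc beta) < c.
    rewrite cmod_rc ger0_norm; last by rewrite divr_ge0 ?(ltW den)//; lra.
    by rewrite ltr_pdivrMr.
  have := safe _ recG; rewrite mulr0 addr0 add0r divr1 => /(_ Wz _ betac).
  suff -> : uu * ((rc beta + rc t) / (1 + rc t * rc beta)) = b by [].
  rewrite [RHS]bE -rc1 -rcM -!rcD -rcV -rcM; congr (_ * rc _).
  have den2 : 0 < 1 - t ^+ 2 by rewrite subr_gt0 -[ltLHS]real_normK ?num_real// expr_lt1.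
  have E1 : 1 + t * beta = (1 - t ^+ 2) / (1 - t * cmod b).
    by rewrite /beta; field; rewrite gt_eqF.
  rewrite E1 /beta; field; rewrite !gt_eqF//.
have q0 : 0 < c * (1 - inf S) by rewrite mulr_gt0// subr_gt0.
have ztR : cmod zeta < inf S.
  by rewrite zt -[ltRHS]mul1r -ltr_pdivrMr//; lra.
have RV : inf S <= 1 by exact: ltW.
set E := connected_component D x.
have inE b' : cmod b' < inf S -> E (phi b').
  move=> b'R; rewrite /E -p0; apply: (disc_component pG RV _ b'R) => b'' b''R.
  by split; [apply: (proj2 pG); exact: lt_trans R1 | exact: inU].
have Dx : D x by split=> //; exact/WU/VW.
have Ed : is_domain E by exact: component_domain.
(* Rescaled by the exit radius, phi becomes a disc of the component E, and zeta gets the parameter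
   of modulus t / inf S. *)
have pE : holomorphic_disc E (fun h => phi (rc (inf S) * h)).
  split=> a a1.
    by apply: (proj1 (disc_rescale _ pG)) => //; rewrite cmod_rc gtr0_norm.
  by apply: inE; rewrite cmodM cmod_rc gtr0_norm// gtr_pMr.
have [tau tau0 tauE] : exists2 tau : R, 0 <= tau & th tau = t / inf S.
  by apply: th_surj; rewrite divr_ge0 ?(ltW R0)//= ltr_pdivrMr// mul1r -zt.
have kz : kd E x (phi zeta) <= tau.
  have e1 : rc (inf S) * (rc (inf S)^-1 * zeta) = zeta.
    by rewrite mulrA [rc (inf S) * _]mulrC rcVK ?gt_eqF// mul1r.
  have := @kd_disc E _ (rc (inf S)^-1 * zeta) tau Ed pE.
  rewrite e1 mulr0 p0; apply.
  by rewrite cmodM cmod_rc gtr0_norm ?invr_gt0// zt tauE mulrC.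
have fz := far x (phi zeta) Gx Vx (inE _ ztR) Wz.
have h1 : 1 - t / inf S <= 2 * expR (- (2 * tau)) by apply: th_exp; rewrite tauE.
have h2 : expR (- (2 * tau)) <= expR (2 * C) * expR (- (2 * kd G x o)).
  by rewrite -expRD ler_expR; lra.
have h3 : 1 - inf S <= M * expR (- (2 * kd G x o)).
  have h4 : c * (1 - inf S) <= 8 * (expR (2 * C) * expR (- (2 * kd G x o))) by lra.
  have -> : 8 / c * expR (2 * C) * expR (- (2 * kd G x o)) =
    8 * (expR (2 * C) * expR (- (2 * kd G x o))) / c by ring.
  by rewrite ler_pdivlMr// mulrC.
apply: (escape_arith c0 (le_trans cR Ral) (expR_ge0 _) M0); lra.
Qed.

End Cases.

Theorem theorem9 (R : realType) (n : nat) (Omega : set (Cn R n)) (p : Cn R n)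
    (lambda : R) (U : set (Cn R n)) :
  is_domain Omega -> hyperbolic Omega -> boundary Omega p -> 1 <= lambda ->
  neighbourhood p U -> bounded_set U ->
  visible lambda Omega p \/
  (visible lambda (Omega `&` U) p /\ hyperbolic_at Omega p) ->
  exists (V : set (Cn R n)) (C : R),
    [/\ neighbourhood p V, relatively_compact V U, 0 <= C &
      forall z w : Cn R n, (Omega `&` V) z -> (Omega `&` V) w ->
        connected_component (Omega `&` U) z w ->
        (kobayashi_comp (Omega `&` U) z w <= kobayashi Omega z w + C%:E)%E].
Proof.
move=> Gd Gh _ l1 [Uo Up] _ hyp.
have [[q Gq] Gop _] := Gd.
case: hyp => [vis|[vis hat]].
(* Visibility is used at two scales: inside U it yields the escape bound on a smaller W, and inside
   W it yields arcs along which this bound is available. *)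
- have hgeo (W : set (Cn R n)) L g : 0 <= L -> unit_speed Omega 0 L g ->
      L <= kd Omega (g 0) (g L) + 1 -> forall b, 0 <= b -> b <= L ->
      (forall t, 0 <= t <= b -> W (g t)) -> geodesic lambda 1 Omega 0 b g.
    by move=> _ hg hL b _ bL _; exact: geodesic_self hL bL.
  have [W [K1 [[Wo Wp] [_ WU] K1c K1D trap1]]] :=
    visible_trapped Uo Up (@subIsetl _ _ _) (vis 1 ler01) (hgeo U).
  have {}WU : W `<=` U by move=> x Wx; apply: WU; exact: subset_closure.
  have [B B0 esc] := escape_visible Gd Gh Gq Uo K1c K1D trap1.
  have [V [K [Vp [Vc VW] Kc KD trap]]] :=
    visible_trapped Wo Wp (@subIsetl _ _ _) (vis 1 ler01) (hgeo W).
  have KU : K `<=` Omega `&` U by move=> x /KD[? /WU].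
  have [C C0 hC] := localization Gd Uo Gq B0 WU esc Kc KU trap.
  by exists V, C; split=> //; split=> // x /VW /WU.
- have [r [c [r0 c01 rU safe]]] := hyperbolic_at_safe Gd Gh hat (conj Uo Up).
  pose W1 := [set y : Cn R n | nrm (y - p) < r].
  have [W [C1 [[Wo Wp] WW1 C10 far]]] := visible_component_far Gd Uo Gq l1
    (ball_neighbourhood p r0) (bounded_ball p r) rU (vis 1 ler01).
  have [B B0 esc] := escape_local Gd Uo c01 rU WW1 C10 safe far.
  have {}WU : W `<=` U by move=> x /WW1 /rU.
  (* This excess depends on B, hence on the first application of visibility, which was made with
     excess 1. *)
  pose eps := 1 + profile_const B * pi.
  have eps0 : 0 <= eps.
    by rewrite addr_ge0// mulr_ge0 ?pi_ge0// /profile_const addr_ge0// !mulr_ge0// expR_ge0.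
  have GWD : Omega `&` W `<=` Omega `&` U by move=> x [? /WU].
  have hgeo L g : 0 <= L -> unit_speed Omega 0 L g ->
      L <= kd Omega (g 0) (g L) + 1 -> forall b, 0 <= b -> b <= L ->
      (forall t, 0 <= t <= b -> W (g t)) -> geodesic lambda eps (Omega `&` U) 0 b g.
    move=> L0 hg hL b b0 bL gW.
    have [c' hc] := us_profile Gd Gq B0 L0 hg hL.
    exact: (geodesic_along Gd B0 WU esc hg hL hc l1 b0 bL gW).
  have [V [K [Vp [Vc VW] Kc KD trap]]] :=
    visible_trapped Wo Wp GWD (vis eps eps0) hgeo.
  have KU : K `<=` Omega `&` U by move=> x /KD[].
  have [C C0 hC] := localization Gd Uo Gq B0 WU esc Kc KU trap.
  by exists V, C; split=> //; split=> // x /VW /WU.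
Qed.
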